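(* Let $k$ be an algebraically closed field of characteristic zero, let $A$ be a finite dimensional semisimple Hopf algebra over $k$, and let $B$ be a Hopf subalgebra of $A$. Then $B \subset A$ is a depth one extension if and only if $B$ is a normal Hopf subalgebra of $A$ and $\mathrm{Rep}(A^* )$ acts trivially on $\mathrm{Rep}(B)$.
   Context: All modules and comodules are finite dimensional, $S$ denotes the antipode, and Sweedler's notation is used with the summation sign dropped: $\Delta(a) = a_1 \otimes a_2$. Depth one: an extension of $k$-algebras $B \subset A$ is a depth one extension if there exists a positive integer $n$ such that $A$ is isomorphic to a direct summand of $B^n$ as a $B$-$B$-bimodule. Normality: a Hopf subalgebra $B \subset A$ is normal if it is closed under both the left and the right adjoint actions of $A$ on itself, i.e. $a_1 B S(a_2) \subset B$ and $S(a_1) B a_2 \subset B$ for all $a \in A$. Action of $\mathrm{Rep}(A^* )$ on $\mathrm{Rep}(B)$: let $B$ be a normal Hopf subalgebra of $A$. A left $A^*$-module $W$ is the same thing as a right $A$-comodule, with coaction written $w \mapsto w_0 \otimes w_1$ (and iterated coaction $w \mapsto w_0 \otimes w_1 \otimes w_2 \in W \otimes A \otimes A$). For a left $B$-module $M$, the vector space $W \otimes M$ is a left $B$-module via $$b(w \otimes m) = w_0 \otimes (S(w_1)\, b\, w_2)m, \qquad b \in B,\ w \in W,\ m \in M.$$ One says that $\mathrm{Rep}(A^* )$ acts trivially on $\mathrm{Rep}(B)$ if for every right $A$-comodule $W$ and every left $B$-module $M$ one has $W \otimes M \cong M^{\dim W}$ (the direct sum of $\dim W$ copies of $M$) as $B$-modules.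 *)

(* Defs.v *)
From HB Require Import structures.
From mathcomp Require Import all_boot all_order all_algebra all_field.

Set Implicit Arguments.
Unset Strict Implicit.
Unset Printing Implicit Defensive.

Import GRing.Theory.
Local Open Scope ring_scope.

(* The tensor product of two finite dimensional spaces is modelled by the     *)
(* matrices of coordinates: ptens v w is the pure tensor of v and w, and      *)
(* tlift f is the linear map out of tens V W induced by a bilinear f : on     *)
(* t = sum of v_i (x) w_i one has tlift f t = sum of f v_i w_i (see tliftE).  *)
(* Sweedler's notation is rendered through tlift: the expression f(a_1, a_2)  *)
(* is tlift f (comul a).                                                      *)
Section Tensor.
Variables (k : fieldType) (V W : vectType k).

Definition tens : Type := 'M[k]_(\dim {:V}, \dim {:W}).
HB.instance Definition _ := Vector.copy tens 'M[k]_(\dim {:V}, \dim {:W}).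

Definition ptens (v : V) (w : W) : tens :=
  \matrix_(i, j) (coord (vbasis {:V}) i v * coord (vbasis {:W}) j w).

Definition tlift (X : vectType k) (f : V -> W -> X) (t : tens) : X :=
  \sum_(i < \dim {:V}) \sum_(j < \dim {:W})
    t i j *: f (vbasis {:V})`_i (vbasis {:W})`_j.

Lemma tlift_is_linear (X : vectType k) (f : V -> W -> X) : linear (tlift f).
Proof.
move=> a s t; rewrite /tlift scaler_sumr -big_split; apply: eq_bigr => i _.
rewrite scaler_sumr -big_split; apply: eq_bigr => j _.
by rewrite !mxE scalerDl scalerA.
Qed.

Lemma tliftE (X : vectType k) (f : V -> W -> X) (v : V) (w : W) :
    (forall w, linear (f^~ w)) -> (forall v, linear (f v)) ->
  tlift f (ptens v w) = f v w.
Proof.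
move=> fl fr.
pose gl w := HB.pack_for {linear V -> X} (f^~ w)
  (GRing.isLinear.Build k V X *:%R (f^~ w) (fl w)).
pose gr v := HB.pack_for {linear W -> X} (f v)
  (GRing.isLinear.Build k W X *:%R (f v) (fr v)).
rewrite [v in RHS](coord_vbasis (memvf v)) -[RHS]/(gl w _) linear_sum.
apply: eq_bigr => i _; rewrite linearZ /= -[f _ w]/(gr _ w).
rewrite [w in RHS](coord_vbasis (memvf w)) linear_sum scaler_sumr.
by apply: eq_bigr => j _; rewrite linearZ scalerA mxE.
Qed.

End Tensor.

HB.mixin Record Falgebra_isHopf (k : fieldType) A of Falgebra k A := {
  comul : 'Hom(A, tens A A);
  counit : {scalar A};
  antipode : 'Hom(A, A);
  comulA : forall a : A,
    tlift (fun x y => ptens x (comul y)) (comul a)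
    = tlift (fun x y => tlift (fun x1 x2 => ptens x1 (ptens x2 y)) (comul x))
        (comul a);
  counitl : forall a : A, tlift (fun x y => counit x *: y) (comul a) = a;
  counitr : forall a : A, tlift (fun x y => counit y *: x) (comul a) = a;
  comul1 : comul 1 = ptens 1 1;
  comulM : forall a b : A,
    comul (a * b)
    = tlift (fun x1 x2 => tlift (fun y1 y2 => ptens (x1 * y1) (x2 * y2))
                            (comul b))
        (comul a);
  counit1 : counit 1 = 1;
  counitM : forall a b : A, counit (a * b) = counit a * counit b;
  antipodel : forall a : A,
    tlift (fun x y => antipode x * y) (comul a) = counit a *: 1;
  antipoder : forall a : A,
    tlift (fun x y => x * antipode y) (comul a) = counit a *: 1
}.

#[short(type="hopfAlgType")]
HB.structure Definition HopfAlgebra (k : fieldType) :=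
  { A of Falgebra k A & Falgebra_isHopf k A }.

Section Modules.
Variables (k : fieldType) (R : falgType k).

Record is_lmodule (M : vectType k) (act : R -> M -> M) : Prop := IsLmodule {
  lmodule_linl : forall m, linear (act^~ m);
  lmodule_linr : forall r, linear (act r);
  lmodule_1 : forall m, act 1 m = m;
  lmodule_M : forall r s m, act (r * s) m = act r (act s m)
}.

Definition submodule (M : vectType k) (act : R -> M -> M) (U : {vspace M}) :=
  forall r u, u \in U -> act r u \in U.

Definition semisimple_lmodule (M : vectType k) (act : R -> M -> M) :=
  forall U, submodule act U ->
  exists V, [/\ submodule act V, (U + V)%VS = fullv & (U :&: V)%VS = 0%VS].

Definition lmodule_iso (M N : vectType k) (aM : R -> M -> M)
    (aN : R -> N -> N) :=
  exists2 f : 'Hom(M, N), bijective f & forall r m, f (aM r m) = aN r (f m).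

Definition lmodule_power (n : nat) (M : vectType k) (act : R -> M -> M)
    (r : R) (u : {ffun 'I_n -> M}) : {ffun 'I_n -> M} :=
  [ffun i => act r (u i)].

(* la is a left action and ra a right action, with arguments in the order in  *)
(* which they are written: la r m is r m and ra m r is m r.                   *)
Definition subbimodule (M : vectType k) (la : R -> M -> M) (ra : M -> R -> M)
    (U : {vspace M}) :=
  forall r u, u \in U -> la r u \in U /\ ra u r \in U.

Definition bimodule_iso_summand (M N : vectType k)
    (lM : R -> M -> M) (rM : M -> R -> M)
    (lN : R -> N -> N) (rN : N -> R -> N) :=
  exists U V : {vspace N},
    [/\ subbimodule lN rN U, subbimodule lN rN V,
        (U + V)%VS = fullv, (U :&: V)%VS = 0%VS
      & exists f : 'Hom(M, N),
        [/\ injective f, limg f = U,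
            forall r m, f (lM r m) = lN r (f m)
          & forall r m, f (rM m r) = rN (f m) r]].

End Modules.

Definition semisimple_algebra (k : fieldType) (R : falgType k) :=
  forall (M : vectType k) (act : R -> M -> M),
  is_lmodule act -> semisimple_lmodule act.

Definition depth_one (k : fieldType) (A : falgType k) (B : {aspace A}) :=
  exists2 n : nat, (0 < n)%N &
    bimodule_iso_summand
      (fun (b : subvs_of B) (a : A) => vsval b * a)
      (fun (a : A) (b : subvs_of B) => a * vsval b)
      (fun (b : subvs_of B) (x : {ffun 'I_n -> subvs_of B}) =>
         [ffun i => b * x i])
      (fun (x : {ffun 'I_n -> subvs_of B}) (b : subvs_of B) =>
         [ffun i => x i * b]).

Section Hopf.
Variables (k : fieldType) (A : hopfAlgType k).

Definition tensv (U V : {vspace A}) : {vspace tens A A} :=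
  <<[seq ptens u v | u <- vbasis U, v <- vbasis V]>>%VS.

(* An {aspace A} may have a unit other than that of A, whence 1 \in B.        *)
Definition hopf_subalgebra (B : {aspace A}) :=
  [/\ 1 \in B, (comul @: B <= tensv B B)%VS & (antipode @: B <= B)%VS].

Definition adl (a b : A) : A :=
  tlift (fun a1 a2 => a1 * b * antipode a2) (comul a).

Definition adr (a b : A) : A :=
  tlift (fun a1 a2 => antipode a1 * b * a2) (comul a).

Definition normal_hopf (B : {aspace A}) :=
  forall a b, b \in B -> adl a b \in B /\ adr a b \in B.

Record is_rcomodule (W : vectType k) (rho : 'Hom(W, tens W A)) : Prop :=
  IsRcomodule {
  coactA : forall w,
    tlift (fun w0 a => ptens w0 (comul a)) (rho w)
    = tlift (fun w' a => tlift (fun w0 w1 => ptens w0 (ptens w1 a)) (rho w'))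
        (rho w);
  coact_counit : forall w, tlift (fun (w0 : W) (a : A) => counit a *: w0) (rho w) = w
}.

(* b (w (x) m) = w_0 (x) (S(w_1) b w_2) m. The middle factor is adr w_1 b,    *)
(* which lies in B when B is normal; vsproj B then only views it as an        *)
(* element of subvs_of B.                                                     *)
Definition twisted_act (B : {aspace A})
    (W : vectType k) (rho : 'Hom(W, tens W A))
    (M : vectType k) (act : subvs_of B -> M -> M)
    (b : subvs_of B) : tens W M -> tens W M :=
  tlift (fun w m =>
    tlift (fun w0 w1 => ptens w0 (act (vsproj B (adr w1 (vsval b))) m))
      (rho w)).

Definition acts_trivially (B : {aspace A}) :=
  forall (W : vectType k) (rho : 'Hom(W, tens W A)), is_rcomodule rho ->
  forall (M : vectType k) (act : subvs_of B -> M -> M), is_lmodule act ->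
  lmodule_iso (twisted_act rho act) (lmodule_power (n := \dim {:W}) act).

End Hopf.

(* Main.v *)
Require Import Defs.
From HB Require Import structures.
From mathcomp Require Import all_boot all_order all_algebra all_field.

(** Both sides of the equivalence say, up to normality, that the inclusion of
B in A is invisible to annihilation: for c, d in B,

      if c b d = 0 for all b in B, then c a d = 0 for all a in A

([annihilation_extends]).

- If B is of depth one, every a is a sum of products f(a) z with f a bimodule
  map from A to B and z in the centralizer of B, and c f(a) z d = c f(a) d z
  ([coords_annihilation]).
- If the action is trivial, take the module M = B d and the regular comodule
  W = A.  Since c kills M, it kills the twisted module A (x) M, a power of M.
  Collapsing a_1 (x) (S(a_2) c a_3) d to the product of its factors gives
  c a d = 0 ([trivial_action_annihilation]).

For semisimple A the annihilation property governs the structure of B.  Taking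
d = c, it shows that c B c = 0 only for c = 0, since A c would be a left ideal
of square zero; taking c and d to be complementary central idempotents z and
1 - z of B, it shows that z is central in A.  Over an algebraically closed
field a minimal left ideal of a semiprime B is B p with p B p = k p, the pairing
of p B with B p is perfect, and dual bases x_i, y_i give matrix units x_i y_j
whose unit is a central idempotent.  So B is a sum of matrix blocks, packaged
as an induction principle on central idempotents ([block_induction]).  Both
implications back follow block by block, with z the unit of a block, central in
A as well.

- The summand z A is a tensor product of the matrix block with its centralizer:
  any linear form psi on A yields the bimodule map sending a to the sum of the
  psi(E_0i a E_j0) E_ij, and such maps coordinatize z A, whence depth one
  ([block_coords]).
- A module over a matrix block is determined by its dimension.  In the twisted
  module W (x) M a central z acts as on the second factor, so each block cuts
  out of W (x) M and of the direct sum of dim W copies of M pieces of the same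
  dimension, and the two modules are isomorphic ([lmodule_iso_of_blocks]).

It remains to see that depth one forces normality.  A bimodule map from A to B
takes the two-sided integral of the semisimple algebra A to a two-sided
integral of B, and one of them has nonzero counit; normalize it to e.  As A is
generated by B and its centralizer, e is central in A.  Then
S(a_1) e_1 a_2 (x) e_2 = e_1 (x) a_1 e_2 S(a_2), so that a contraction of one
side, which involves one of the adjoint actions, is a contraction of the other,
which stays in B.  As every element of B is a contraction of the coproduct of e,
both adjoint actions preserve B ([central_integral_normal]). *)

Set Implicit Arguments.
Unset Strict Implicit.
Unset Printing Implicit Defensive.

Import GRing.Theory.
Local Open Scope ring_scope.

(** * Linear maps out of a tensor product *)

Section Linear.
Variable k : fieldType.
Implicit Types U V W X Y : vectType k.

(** Linear maps are handled as bare functions with a proof of linearity, so that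
the expressions under Sweedler sums need not be rebuilt as structures. *)
Definition linpack U V (g : U -> V) (gl : linear g) : {linear U -> V} :=
  HB.pack_for {linear U -> V} g (GRing.isLinear.Build k U V *:%R g gl).

Lemma lin_sum U V (g : U -> V) I (r : seq I) (P : pred I) (F : I -> U) :
  linear g -> g (\sum_(i <- r | P i) F i) = \sum_(i <- r | P i) g (F i).
Proof. by move=> gl; rewrite -[g]/(linpack gl : _ -> _) linear_sum. Qed.

Lemma linD U V (g : U -> V) u v : linear g -> g (u + v) = g u + g v.
Proof. by move=> gl; rewrite -[g]/(linpack gl : _ -> _) linearD. Qed.

Lemma linZ U V (g : U -> V) a u : linear g -> g (a *: u) = a *: g u.
Proof. by move=> gl; rewrite -[g]/(linpack gl : _ -> _) linearZ. Qed.

Lemma lin0 U V (g : U -> V) : linear g -> g 0 = 0.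
Proof. by move=> gl; rewrite -[g]/(linpack gl : _ -> _) linear0. Qed.

Lemma lin_id V : linear (fun x : V => x). Proof. by []. Qed.

Lemma lin_comp U V W (g : V -> W) (f : U -> V) :
  linear g -> linear f -> linear (fun x => g (f x)).
Proof. by move=> gl fl a u v /=; rewrite fl gl. Qed.

Lemma lin_lfun U V (g : 'Hom(U, V)) : linear g.
Proof. exact: linearP. Qed.

Lemma lin_tlift_arg U V W X (f : U -> tens V W) (g : V -> W -> X) :
  linear f -> linear (fun x => tlift g (f x)).
Proof. by move=> fl; apply: lin_comp fl; apply: tlift_is_linear. Qed.

Lemma lin_tlift_fun U V W X (F : U -> V -> W -> X) (t : tens V W) :
  (forall v w, linear (fun x => F x v w)) -> linear (fun x => tlift (F x) t).
Proof.
move=> Fl a u v; rewrite /tlift scaler_sumr -big_split; apply: eq_bigr => i _.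
rewrite scaler_sumr -big_split; apply: eq_bigr => j _ /=.
by rewrite Fl scalerDr !scalerA mulrC.
Qed.

Lemma lin_sumf U V I (r : seq I) (P : pred I) (F : U -> I -> V) :
  (forall i, linear (fun x => F x i)) ->
  linear (fun x => \sum_(i <- r | P i) F x i).
Proof.
move=> Fl a u v; rewrite scaler_sumr -big_split; apply: eq_bigr => i _.
exact: Fl.
Qed.

Lemma lin_add U V (f g : U -> V) :
  linear f -> linear g -> linear (fun x => f x + g x).
Proof. by move=> fl gl a u v; rewrite fl gl scalerDr addrACA. Qed.

Lemma lin_opp U V (f : U -> V) : linear f -> linear (fun x => - f x).
Proof. by move=> fl a u v; rewrite fl opprD scalerN. Qed.

Lemma lin_scaler U V (c : k) (f : U -> V) :
  linear f -> linear (fun x => c *: f x).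
Proof. by move=> fl a u v; rewrite fl scalerDr !scalerA mulrC. Qed.

Lemma lin_scalel U V (f : U -> k^o) (v : V) :
  linear f -> linear (fun x => f x *: v).
Proof. by move=> fl a u u'; rewrite fl scalerDl scalerA. Qed.

Lemma lin_ptensl U V W (f : U -> V) (w : W) :
  linear f -> linear (fun x => ptens (f x) w).
Proof.
by move=> fl a u v; apply/matrixP=> i j; rewrite !mxE fl linearP mulrDl mulrA.
Qed.

Lemma lin_ptensr U V W (v : V) (f : U -> W) :
  linear f -> linear (fun x => ptens v (f x)).
Proof.
move=> fl a u w; apply/matrixP=> i j; rewrite !mxE fl linearP mulrDr.
by rewrite mulrCA.
Qed.

Lemma lin_mull U (A : falgType k) (f : U -> A) (c : A) :
  linear f -> linear (fun x => f x * c).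
Proof. by move=> fl a u v; rewrite fl mulrDl scalerAl. Qed.

Lemma lin_mulr U (A : falgType k) (c : A) (f : U -> A) :
  linear f -> linear (fun x => c * f x).
Proof. by move=> fl a u v; rewrite fl mulrDr scalerAr. Qed.

Definition bilinear_map U V X (f : U -> V -> X) :=
  (forall v, linear (f^~ v)) /\ (forall u, linear (f u)).

Lemma eq_tlift U V X (f g : U -> V -> X) (t : tens U V) :
  f =2 g -> tlift f t = tlift g t.
Proof.
by move=> fg; apply: eq_bigr => i _; apply: eq_bigr => j _; rewrite fg.
Qed.

Lemma tlift_sum U V X I (r : seq I) (F : I -> U -> V -> X) (t : tens U V) :
  tlift (fun x y => \sum_(i <- r) F i x y) t = \sum_(i <- r) tlift (F i) t.
Proof.
rewrite /tlift.
under eq_bigr => i _ do under eq_bigr => j _ do rewrite scaler_sumr.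
by under eq_bigr => i _ do rewrite exchange_big; rewrite exchange_big.
Qed.

Lemma lin_tlift U V X Y (g : X -> Y) (f : U -> V -> X) (t : tens U V) :
  linear g -> g (tlift f t) = tlift (fun x y => g (f x y)) t.
Proof.
move=> gl; rewrite /tlift lin_sum //; apply: eq_bigr => i _.
by rewrite lin_sum //; apply: eq_bigr => j _; rewrite linZ.
Qed.

Lemma tlift_exchange U V (U1 V1 : vectType k) X
    (F : U -> V -> U1 -> V1 -> X) s t :
  tlift (fun x y => tlift (F x y) s) t =
  tlift (fun u v => tlift (fun x y => F x y u v) t) s.
Proof.
rewrite /tlift.
under eq_bigr => i _ do under eq_bigr => j _ do rewrite scaler_sumr.
under eq_bigr => i _ do rewrite exchange_big.
rewrite exchange_big; apply: eq_bigr => p _.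
under eq_bigr => i _ do
  under eq_bigr => j _ do
    (rewrite scaler_sumr;
     under eq_bigr => q _ do rewrite scalerA mulrC -scalerA).
under eq_bigr => i _ do rewrite exchange_big.
rewrite exchange_big; apply: eq_bigr => q _; rewrite scaler_sumr.
by apply: eq_bigr => i _; rewrite scaler_sumr.
Qed.

Lemma tens_decomp U V (t : tens U V) : tlift (@ptens k U V) t = t.
Proof.
apply/matrixP=> p q; rewrite /tlift summxE (bigD1 p) //= summxE (bigD1 q) //=.
have fU := basis_free (vbasisP {:U}); have fV := basis_free (vbasisP {:V}).
rewrite !mxE !coord_free // !eqxx !mulr1 !big1 ?addr0 //.
  move=> i ip; rewrite summxE big1 // => j _; rewrite !mxE !coord_free //.
  by rewrite (negPf ip) mul0r mulr0.
move=> j jq; rewrite !mxE !coord_free // (negPf jq) !mulr0 //.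
Qed.
End Linear.

Lemma lin_counit (k : fieldType) (A : hopfAlgType k) (U : vectType k)
    (f : U -> A) : linear f -> linear (fun x => counit (f x) : k^o).
Proof. by move=> fl a u v; rewrite fl linearP. Qed.

(** Linearity of an expression is decided by its head symbol, the variable
occurring in exactly one argument; bilinear functions are looked up among the
hypotheses. *)
Ltac lin_step :=
  first
  [ assumption
  | exact: lin_id
  | exact: lin_lfun
  | match goal with
    | H : bilinear_map ?f |- linear (?f _) => exact: (H.2 _)
    | H : bilinear_map ?f |- linear (fun x => ?f _ (@?g x)) =>
         apply: (lin_comp (H.2 _))
    | H : bilinear_map ?f |- linear (fun x => ?f (@?g x) ?v) =>
         apply: (lin_comp (H.1 v))
    | H : forall _, linear _ |- _ => apply: (lin_comp (H _))
    | H : linear ?f |- linear (fun x => ?f (@?g x)) => apply: (lin_comp H)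
    end
  | lazymatch goal with |- @GRing.linear_for _ _ _ _ ?h =>
      lazymatch h with
      | fun x => @GRing.opp _ _ => apply: lin_opp
      | fun x => @GRing.add _ _ _ => apply: lin_add
      | fun x => bigop _ _ _ => apply: lin_sumf => ?
      | fun x => @tlift _ _ _ _ _ _ =>
          first [apply: lin_tlift_arg | apply: lin_tlift_fun => ? ?]
      | fun x => @ptens _ _ _ _ _ =>
          first [apply: lin_ptensr | apply: lin_ptensl]
      | fun x => @fun_of_lfun _ _ _ ?g _ => apply: (lin_comp (lin_lfun g))
      | fun x => @GRing.scale _ _ _ _ =>
          first [apply: lin_scaler | apply: lin_scalel]
      | fun x => @GRing.mul _ _ _ => first [apply: lin_mulr | apply: lin_mull]
      | @GRing.mul _ ?c => exact: (lin_mulr c (@lin_id _ _))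
      | @GRing.scale _ _ ?c => exact: (lin_scaler c (@lin_id _ _))
      | @ptens _ _ _ ?v => exact: (lin_ptensr v (@lin_id _ _))
      | @tlift _ _ _ _ _ => exact: tlift_is_linear
      | _ => apply: lin_counit
      end
    end ].

Ltac lin := repeat (cbv beta; lin_step).
Ltac bilin := split=> ? /=; lin.

(** * Sweedler calculus in a Hopf algebra *)

Reserved Notation "\sw_ ( x , y <- a ) F"
  (at level 41, F at level 41, x name, y name, a at level 50,
   format "\sw_ ( x ,  y  <-  a )  F").
Notation "\sw_ ( x , y <- a ) F" :=
  (tlift (fun x y => F) (comul a)) : ring_scope.

Section Sweedler.
Variables (k : fieldType) (A : hopfAlgType k).
Implicit Types (X : vectType k) (a b : A).

Definition trilinear_map (U V W X : vectType k) (F : U -> V -> W -> X) :=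
  [/\ forall v w, linear (fun u => F u v w),
      forall u w, linear (fun v => F u v w) & forall u v, linear (F u v)].

Lemma coact_coassoc (W : vectType k) (rho : 'Hom(W, tens W A)) X
    (F : W -> A -> A -> X) w : is_rcomodule rho -> trilinear_map F ->
  tlift (fun w0 x => \sw_(x1, x2 <- x) F w0 x1 x2) (rho w) =
  tlift (fun w' x => tlift (fun w0 x1 => F w0 x1 x) (rho w')) (rho w).
Proof.
move=> rhoP [F1 F2 F3].
pose G (t : tens W (tens A A)) : X := tlift (fun x u => tlift (F x) u) t.
have Gl : linear G by apply: tlift_is_linear.
have GE x u : G (ptens x u) = tlift (F x) u.
  apply: tliftE => [v|v]; first by apply: lin_tlift_fun => ? ?; apply: F1.
  exact: tlift_is_linear.
have := congr1 G (coactA rhoP w); rewrite !(lin_tlift _ _ Gl).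
under eq_tlift => x y do rewrite GE.
under [RHS]eq_tlift => x y do rewrite (lin_tlift _ _ Gl).
move=> ->; apply: eq_tlift => x y; apply: eq_tlift => x1 x2.
by rewrite GE tliftE // => v; apply: F2.
Qed.

Lemma regular_rcomodule : is_rcomodule (@comul k A).
Proof. by split=> a; [exact: comulA | exact: counitr]. Qed.

Lemma sw_coassoc X (F : A -> A -> A -> X) a : trilinear_map F ->
  \sw_(x, y <- a) \sw_(y1, y2 <- y) F x y1 y2 =
  \sw_(x, y <- a) \sw_(x1, x2 <- x) F x1 x2 y.
Proof. exact: coact_coassoc regular_rcomodule. Qed.

Lemma sw_counitl X (g : A -> X) a : linear g ->
  \sw_(x, y <- a) (counit x *: g y) = g a.
Proof.
move=> gl; rewrite -[in RHS](counitl a) lin_tlift //.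
by apply: eq_tlift => x y; rewrite linZ.
Qed.

Lemma sw_counitr X (g : A -> X) a : linear g ->
  \sw_(x, y <- a) (counit y *: g x) = g a.
Proof.
move=> gl; rewrite -[in RHS](counitr a) lin_tlift //.
by apply: eq_tlift => x y; rewrite linZ.
Qed.

Lemma sw_antipodel X (g : A -> X) a : linear g ->
  \sw_(x, y <- a) g (antipode x * y) = counit a *: g 1.
Proof. by move=> gl; rewrite -lin_tlift // antipodel linZ. Qed.

Lemma sw_antipoder X (g : A -> X) a : linear g ->
  \sw_(x, y <- a) g (x * antipode y) = counit a *: g 1.
Proof. by move=> gl; rewrite -lin_tlift // antipoder linZ. Qed.

Lemma sw_mul X (f : A -> A -> X) a b : bilinear_map f ->
  \sw_(x, y <- a * b) f x y =
  \sw_(a1, a2 <- a) \sw_(b1, b2 <- b) f (a1 * b1) (a2 * b2).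
Proof.
move=> fb; rewrite comulM lin_tlift; last exact: tlift_is_linear.
apply: eq_tlift => a1 a2; rewrite lin_tlift; last exact: tlift_is_linear.
by apply: eq_tlift => b1 b2; rewrite tliftE // => ?; lin.
Qed.

(** The next three lemmas are a_1 S(a_2) (x) a_3 = 1 (x) a,
S(a_1) a_2 (x) a_3 = 1 (x) a and a_1 (x) a_2 S(a_3) = a (x) 1. *)
Lemma sw_antipoderK X (f : A -> A -> X) a : bilinear_map f ->
  \sw_(x, y <- a) \sw_(y1, y2 <- y) f (x * antipode y1) y2 = f 1 a.
Proof.
move=> fb; rewrite (sw_coassoc (F := fun x y z => f (x * antipode y) z)).
  under eq_tlift => x y do rewrite (sw_antipoder _ (fb.1 y)).
  by rewrite sw_counitl //; lin.
by split=> ? ? /=; lin.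
Qed.

Lemma sw_antipodelK X (f : A -> A -> X) a : bilinear_map f ->
  \sw_(x, y <- a) \sw_(y1, y2 <- y) f (antipode x * y1) y2 = f 1 a.
Proof.
move=> fb; rewrite (sw_coassoc (F := fun x y z => f (antipode x * y) z)).
  under eq_tlift => x y do rewrite (sw_antipodel _ (fb.1 y)).
  by rewrite sw_counitl //; lin.
by split=> ? ? /=; lin.
Qed.

Lemma sw_mul_antipodeK X (f : A -> A -> X) a : bilinear_map f ->
  \sw_(x, y <- a) \sw_(x1, x2 <- x) f x1 (x2 * antipode y) = f a 1.
Proof.
move=> fb; rewrite -(sw_coassoc (F := fun x y z => f x (y * antipode z))).
  under eq_tlift => x y do rewrite (sw_antipoder _ (fb.2 x)).
  by rewrite (sw_counitr (g := f^~ 1)) //; lin.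
by split=> ? ? /=; lin.
Qed.

(** The left side is a_1 S(a_2) b a_3, whose first two factors cancel. *)
Lemma adr_mulK a b : \sw_(x, y <- a) (x * adr y b) = b * a.
Proof.
have xl x : linear (fun z : A => x * z) by lin.
under eq_tlift => x y do rewrite /adr (lin_tlift _ _ (xl x)).
rewrite (_ : tlift _ _ =
   \sw_(x, y <- a) \sw_(y1, y2 <- y) (x * antipode y1) * b * y2).
  rewrite (sw_antipoderK (f := fun u v => u * b * v)) ?mul1r//; by bilin.
by apply: eq_tlift => x y; apply: eq_tlift => u v; rewrite !mulrA.
Qed.

End Sweedler.

(** * Adjoint actions and integrals *)

Section Adr.
Variables (k : fieldType) (A : hopfAlgType k).
Implicit Types (X : vectType k) (a b : A).

Lemma bilinear_adr : bilinear_map (@adr k A).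
Proof. by split=> ?; rewrite /adr; lin. Qed.

Lemma adr1 a : adr a 1 = counit a *: 1.
Proof. by rewrite -antipodel; apply: eq_tlift => x y; rewrite mulr1. Qed.

Lemma adrM a b c : adr a (b * c) = \sw_(x, y <- a) adr x b * adr y c.
Proof.
have xl (d : A) : linear (fun z : A => d * z) by lin.
have xr (d : A) : linear (fun z : A => z * d) by lin.
pose F x1 x2 y :=
  \sw_(y1, y2 <- y) antipode x1 * b * x2 * (antipode y1 * c * y2).
transitivity (\sw_(x, y <- a) \sw_(x1, x2 <- x) F x1 x2 y); last first.
  apply: eq_tlift => x y; rewrite (lin_tlift _ _ (xr _)).
  apply: eq_tlift => x1 x2; rewrite (lin_tlift _ _ (xl _)).
  by apply: eq_tlift.
rewrite -(sw_coassoc (F := F)); last by rewrite /F; split=> ? ? /=; lin.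
apply: eq_tlift => x y; rewrite /F.
pose G u v := antipode x * b * (u * c * v).
have -> : antipode x * (b * c) * y = G 1 y by rewrite /G mul1r !mulrA.
rewrite -(sw_antipoderK (f := G)); last by rewrite /G; bilin.
apply: eq_tlift => u y1; apply: eq_tlift => y2 v.
by rewrite /G !mulrA.
Qed.

(** Both factors of S(a_1) z a_2 can be joined past a central z. *)
Lemma adr_central a z : (forall c : A, z * c = c * z) -> adr a z = counit a *: z.
Proof.
move=> zc; rewrite -[z in RHS]mul1r -(sw_antipodel a (g := fun x => x * z)); last first.
  by lin.
by apply: eq_tlift => x y; rewrite -mulrA zc mulrA.
Qed.

End Adr.

Section HopfSub.
Variables (k : fieldType) (A : hopfAlgType k) (B : {aspace A}).
Hypothesis hB : hopf_subalgebra B.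
Implicit Types (X : vectType k) (a b : A).

Lemma hopf_sub1 : 1 \in B. Proof. by case: hB. Qed.

Lemma memv_antipode b : b \in B -> antipode b \in B.
Proof. by case: hB => _ _ SB bB; apply: (subvP SB); apply: memv_img. Qed.

Lemma tlift_sub X (f : A -> A -> X) (U : {vspace X}) (t : tens A A) :
  bilinear_map f -> (forall x y, x \in B -> y \in B -> f x y \in U) ->
  t \in tensv B B -> tlift f t \in U.
Proof.
move=> fb fU; pose h := linfun (linpack (tlift_is_linear f)).
have hE u : h u = tlift f u by rewrite lfunE.
rewrite -hE memv_preim; apply: subvP t; apply/span_subvP => t /allpairsP[[u v]].
case=> /= uB vB ->; rewrite -memv_preim hE (tliftE _ _ fb.1 fb.2).
by rewrite fU // vbasis_mem.
Qed.

Lemma sw_sub X (f : A -> A -> X) (U : {vspace X}) b :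
  bilinear_map f -> (forall x y, x \in B -> y \in B -> f x y \in U) ->
  b \in B -> \sw_(x, y <- b) f x y \in U.
Proof.
move=> fb fU bB; apply: tlift_sub => //.
by case: hB => _ DB _; apply: (subvP DB); apply: memv_img.
Qed.

Lemma eq_sw_sub X (f g : A -> A -> X) b :
  bilinear_map f -> bilinear_map g ->
  (forall x y, x \in B -> y \in B -> f x y = g x y) -> b \in B ->
  \sw_(x, y <- b) f x y = \sw_(x, y <- b) g x y.
Proof.
move=> fb gb fg bB; apply/subr0_eq/eqP; rewrite -memv0.
rewrite (_ : _ - _ = \sw_(x, y <- b) (f x y - g x y)).
  apply: sw_sub => // [|x y xB yB]; first by split=> ?; lin.
  by rewrite fg // subrr mem0v.
rewrite /tlift -sumrB; apply: eq_bigr => i _; rewrite -sumrB.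
by apply: eq_bigr => j _; rewrite scalerBr.
Qed.

Variable e : A.
Hypothesis eB : e \in B.
Hypothesis el : forall b, b \in B -> b * e = counit b *: e.
Hypothesis er : forall b, b \in B -> e * b = counit b *: e.

(** An integral transports multiplication from one tensor leg to the other through
the antipode: e_1 b (x) e_2 = e_1 b_1 (x) e_2 b_2 S(b_3), and e b_1 is a multiple
of e. *)
Lemma integral_shiftr X (f : A -> A -> X) b : bilinear_map f -> b \in B ->
  \sw_(x, y <- e) f (x * b) y = \sw_(x, y <- e) f x (y * antipode b).
Proof.
move=> fb bB.
transitivity (\sw_(b1, b2 <- b) \sw_(u, v <- b1) \sw_(x, y <- e)
                f (x * u) (y * (v * antipode b2))).
  rewrite (sw_mul_antipodeK (f := fun u w => \sw_(x, y <- e) f (x * u) (y * w))).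
    by apply: eq_tlift => x y; rewrite mulr1.
  by split=> ? /=; lin.
rewrite (eq_sw_sub (g := fun b1 b2 =>
    counit b1 *: \sw_(x, y <- e) f x (y * antipode b2))) //; first last.
- move=> b1 b2 b1B _; rewrite tlift_exchange.
  have := sw_mul e b1 (f := fun x y => f x (y * antipode b2)).
  rewrite er // linearZ /= linZ; last exact: tlift_is_linear.
  move=> -> ; last by bilin.
  apply: eq_tlift => x y; apply: eq_tlift => u v.
  by rewrite mulrA.
- by split=> ? /=; lin.
- by split=> ? /=; lin.
by rewrite sw_counitl //; lin.
Qed.

Lemma integral_shiftl X (f : A -> A -> X) b : bilinear_map f -> b \in B ->
  \sw_(x, y <- e) f x (b * y) = \sw_(x, y <- e) f (antipode b * x) y.
Proof.
move=> fb bB.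
transitivity (\sw_(b1, b2 <- b) \sw_(u, v <- b2) \sw_(x, y <- e)
                f (antipode b1 * u * x) (v * y)).
  rewrite (sw_antipodelK (f := fun w v => \sw_(x, y <- e) f (w * x) (v * y))).
    by apply: eq_tlift => x y; rewrite mul1r.
  by split=> ? /=; lin.
rewrite (eq_sw_sub (g := fun b1 b2 =>
    counit b2 *: \sw_(x, y <- e) f (antipode b1 * x) y)) //; first last.
- move=> b1 b2 _ b2B.
  have := sw_mul b2 e (f := fun x y => f (antipode b1 * x) y).
  rewrite el // linearZ /= linZ; last exact: tlift_is_linear.
  move=> -> ; last by bilin.
  by apply: eq_tlift => u v; apply: eq_tlift => x y; rewrite mulrA.
- by split=> ? /=; lin.
- by split=> ? /=; lin.
by rewrite (sw_counitr (g := fun z => \sw_(x, y <- e) f (antipode z * x) y)) //; lin.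
Qed.

Hypothesis e1 : counit e = 1.

(** The first legs of the coproduct of e exhaust B.  From e_1 S(e_2) = 1 one gets
b = e_1 S(e_2) b; expanding S(e_2) b in a basis v_j of B and shifting each
v_j across the coproduct turns b into a contraction of e_1 (x) e_2. *)
Lemma integral_legsl b : b \in B ->
  exists2 phi : A -> k^o, linear phi & b = \sw_(x, y <- e) phi y *: x.
Proof.
move=> bB; pose c j : A -> k^o := coord (vbasis B) j; pose v j := (vbasis B)`_j.
have cl j : linear (c j) by apply: linearP.
have vB (j : 'I_(\dim B)) : v j \in B by apply/vbasis_mem/memt_nth.
exists (fun y => \sum_(j < \dim B) c j (antipode (y * antipode (v j)) * b)).
  by lin.
transitivity (\sw_(x, y <- e) x * antipode y * b).
  by rewrite (sw_antipoder e (g := fun z => z * b)) ?e1 ?scale1r ?mul1r //; lin.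
transitivity (\sw_(x, y <- e) \sum_(j < \dim B) c j (antipode y * b) *: (x * v j)).
  apply: eq_sw_sub => //; first by bilin.
    by bilin.
  move=> x y xB yB; rewrite -mulrA {1}(coord_vbasis (memvM (memv_antipode yB) bB)).
  by rewrite mulr_sumr; apply: eq_bigr => j _; rewrite scalerAr.
rewrite tlift_sum; under [RHS]eq_tlift => x y do rewrite scaler_suml.
rewrite tlift_sum; apply: eq_bigr => j _.
rewrite (integral_shiftr (X := A) (f := fun x y => (c j (antipode y * b) : k) *: x)) //.
by bilin.
Qed.

Lemma integral_legsr b : b \in B ->
  exists2 phi : A -> k^o, linear phi & b = \sw_(x, y <- e) phi x *: y.
Proof.
move=> bB; pose c j : A -> k^o := coord (vbasis B) j; pose v j := (vbasis B)`_j.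
have cl j : linear (c j) by apply: linearP.
have vB (j : 'I_(\dim B)) : v j \in B by apply/vbasis_mem/memt_nth.
exists (fun x => \sum_(j < \dim B) c j (b * antipode (antipode (v j) * x))).
  by lin.
transitivity (\sw_(x, y <- e) b * (antipode x * y)).
  by rewrite (sw_antipodel e (g := fun z => b * z)) ?e1 ?scale1r ?mulr1 //; lin.
transitivity (\sw_(x, y <- e) \sum_(j < \dim B) c j (b * antipode x) *: (v j * y)).
  apply: eq_sw_sub => //; first by bilin.
    by bilin.
  move=> x y xB yB; rewrite mulrA {1}(coord_vbasis (memvM bB (memv_antipode xB))).
  by rewrite mulr_suml; apply: eq_bigr => j _; rewrite scalerAl.
rewrite tlift_sum; under [RHS]eq_tlift => x y do rewrite scaler_suml.
rewrite tlift_sum; apply: eq_bigr => j _.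
rewrite (integral_shiftl (X := A) (f := fun x y => (c j (b * antipode x) : k) *: y)) //.
by bilin.
Qed.

Hypothesis ec : forall a, a * e = e * a.

(** Insert a_3 S(a_4) on the right of e_2, move the pair a_2, a_3 across the
coproduct of the central e, and cancel S(a_1) a_2 on the left of e_1. *)
Lemma central_integral_adjoint X (g : A -> A -> X) a : bilinear_map g ->
  \sw_(x, y <- e) g (adr a x) y = \sw_(x, y <- e) g x (adl a y).
Proof.
move=> gb.
have eC b (h : A -> A -> X) : bilinear_map h ->
    \sw_(b1, b2 <- b) \sw_(x, y <- e) h (b1 * x) (b2 * y) =
    \sw_(b1, b2 <- b) \sw_(x, y <- e) h (x * b1) (y * b2).
  by move=> hb; rewrite -sw_mul // ec sw_mul // tlift_exchange.
transitivity (\sw_(p, q <- a) \sw_(q1, q2 <- q) \sw_(r, s <- q1)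
    \sw_(x, y <- e) g (antipode p * (x * r)) (y * s * antipode q2)).
  under eq_tlift => x y do rewrite (lin_tlift _ _ (gb.1 y)).
  rewrite tlift_exchange; apply: eq_tlift => p q.
  pose f r w := \sw_(x, y <- e) g (antipode p * (x * r)) (y * w).
  transitivity (f q 1).
    by apply: eq_tlift => x y; rewrite mulr1 mulrA.
  rewrite -(sw_mul_antipodeK (f := f)); last by rewrite /f; bilin.
  apply: eq_tlift => q1 q2; apply: eq_tlift => r s; apply: eq_tlift => x y.
  by rewrite mulrA.
transitivity (\sw_(p, q <- a) \sw_(q1, q2 <- q) \sw_(r, s <- q1)
    \sw_(x, y <- e) g (antipode p * (r * x)) (s * y * antipode q2)).
  apply: eq_tlift => p q; apply: eq_tlift => q1 q2.
  by rewrite (eC q1 (fun u w => g (antipode p * u) (w * antipode q2))) //; bilin.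
pose f u v := \sw_(s, q2 <- v) \sw_(x, y <- e) g (u * x) (s * y * antipode q2).
transitivity (f 1 a).
  rewrite -(sw_antipodelK (f := f)); last by rewrite /f; bilin.
  apply: eq_tlift => p q.
  rewrite -(sw_coassoc (F := fun r s q2 =>
     \sw_(x, y <- e) g (antipode p * (r * x)) (s * y * antipode q2))).
    apply: eq_tlift => r q1; apply: eq_tlift => s q2; apply: eq_tlift => x y.
    by rewrite mulrA.
  by split=> ? ? /=; lin.
under [RHS]eq_tlift => x y do rewrite (lin_tlift _ _ (gb.2 x)).
rewrite [RHS]tlift_exchange; apply: eq_tlift => p q; apply: eq_tlift => x y.
by rewrite mul1r.
Qed.

Lemma bilinear_adl : bilinear_map (@adl k A).
Proof. by split=> ?; rewrite /adl; lin. Qed.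

Lemma central_integral_normal : normal_hopf B.
Proof.
move=> a b bB; split.
  have [phi phil ->] := integral_legsr bB.
  rewrite (lin_tlift _ _ (bilinear_adl.2 a)).
  under eq_tlift => x y do rewrite (linZ _ _ (bilinear_adl.2 a)).
  rewrite -(central_integral_adjoint (X := A) (g := fun x y => (phi x : k) *: y));
    last by bilin.
  apply: sw_sub => // [|x y xB yB]; last exact: rpredZ.
  by have adrb := bilinear_adr A; bilin.
have [phi phil ->] := integral_legsl bB.
have adrb := bilinear_adr A.
rewrite (lin_tlift _ _ (adrb.2 a)).
under eq_tlift => x y do rewrite (linZ _ _ (adrb.2 a)).
rewrite (central_integral_adjoint (X := A) (g := fun x y => (phi y : k) *: x));
  last by bilin.
apply: sw_sub => // [|x y xB yB]; last exact: rpredZ.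
by have adlb := bilinear_adl; bilin.
Qed.

End HopfSub.

(** * Subalgebras of a semisimple algebra and their matrix blocks *)

Section LeftIdeal.
Variables (k : fieldType) (A : falgType k).
Hypothesis ssA : semisimple_algebra A.

Lemma regular_lmodule : is_lmodule (fun a x : A => a * x).
Proof. by split=> [m|r|m|r s m]; [lin | lin | exact: mul1r | rewrite mulrA]. Qed.

Lemma left_ideal_complement (U : {vspace A}) :
  (forall r u, u \in U -> r * u \in U) ->
  exists V : {vspace A}, [/\ forall r v, v \in V -> r * v \in V,
    (U + V)%VS = fullv & (U :&: V)%VS = 0%VS].
Proof. exact: (ssA regular_lmodule). Qed.

(** With 1 = u + v along U and a complementary left ideal, any x in U equals
x u + x v, where x u lies in U U = 0 and x v in the complement. *)
Lemma nil_left_ideal0 (U : {vspace A}) :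
  (forall r u, u \in U -> r * u \in U) ->
  (forall x y, x \in U -> y \in U -> x * y = 0) -> forall x, x \in U -> x = 0.
Proof.
move=> Ul UU x xU; have [V [Vl UV UV0]] := left_ideal_complement Ul.
have /memv_addP[u uU [v vV uv1]] : 1 \in (U + V)%VS by rewrite UV memvf.
apply/eqP; rewrite -memv0 -UV0 memv_cap xU /=.
by rewrite -[x]mulr1 uv1 mulrDr UU // add0r Vl.
Qed.

End LeftIdeal.

Section Eigenvector.
Variables (k : closedFieldType) (V : vectType k).

(** A root of the characteristic polynomial of f on U in a basis of U. *)
Lemma closed_eigenvector (f : 'End(V)) (U : {vspace V}) :
  U != 0%VS -> (f @: U <= U)%VS ->
  exists a u, [/\ u \in U, u != 0 & f u = a *: u].
Proof.
move=> U0 fU; set n := \dim U.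
pose M : 'M[k]_n := \matrix_(i, j) coord (vbasis U) j (f (vbasis U)`_i).
have /closed_rootP[a] : size (char_poly M) != 1%N.
  by rewrite size_char_poly eqSS /n dimv_eq0.
rewrite -eigenvalue_root_char => /eigenvalueP[v vM v0].
exists a, (\sum_(i < n) v 0 i *: (vbasis U)`_i); split.
- by apply: rpred_sum => i _; apply/rpredZ/vbasis_mem/memt_nth.
- have /freeP vfree := basis_free (vbasisP U).
  apply: contraNneq v0 => /(vfree (fun i => v 0 i)) v0.
  by apply/eqP/rowP => i; rewrite v0 mxE.
rewrite linear_sum scaler_sumr /=.
have fv (i : 'I_n) : f (vbasis U)`_i \in U.
  by apply/(subvP fU)/memv_img/vbasis_mem/memt_nth.
under eq_bigr => i _.
  rewrite linearZ /= (coord_vbasis (fv i)) scaler_sumr; over.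
rewrite exchange_big; apply: eq_bigr => j _.
move/rowP/(_ j): vM; rewrite !mxE scalerA => <-; rewrite scaler_suml.
by apply: eq_bigr => i _; rewrite scalerA mxE.
Qed.

End Eigenvector.

Section Subalgebra.
Variables (k : fieldType) (A : falgType k) (B : {aspace A}).

(** The common consequence of depth one and of trivial action on which the
structure theory of B rests. *)
Definition annihilation_extends :=
  forall c d, c \in B -> d \in B -> (forall b, b \in B -> c * b * d = 0) ->
  forall a, c * a * d = 0.

Hypothesis ssA : semisimple_algebra A.
Hypotheses (B1 : 1 \in B) (annB : annihilation_extends).

(** If c B c = 0 then c A c = 0, and A c is a left ideal of square zero. *)
Lemma semiprime_sub c : c \in B -> (forall b, b \in B -> c * b * c = 0) -> c = 0.
Proof.
move=> cB cBc; pose U := limg (amulr c).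
have UP u : reflect (exists a, u = a * c) (u \in U).
  apply: (iffP memv_imgP) => [[a _ ->]|[a ->]]; exists a; rewrite ?lfunE ?memvf //.
apply: (nil_left_ideal0 ssA (U := U)).
- by move=> r u /UP[a ->]; apply/UP; exists (r * a); rewrite mulrA.
- move=> _ _ /UP[a ->] /UP[b ->].
  by rewrite -!mulrA [c * (b * c)]mulrA annB // mulr0.
- by apply/UP; exists 1; rewrite mul1r.
Qed.

Lemma semiprime_subP c : c \in B -> c != 0 ->
  exists2 b, b \in B & c * b * c != 0.
Proof.
move=> cB c0; pose U := ((amulr c \o amull c)%VF @: B)%VS.
have [U0|] := eqVneq U 0%VS.
  case/eqP: c0; apply: semiprime_sub => // b bB; apply/eqP.
  by rewrite -memv0 -U0; apply/memv_imgP; exists b; rewrite // !lfunE /= !lfunE.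
rewrite -vpick0; have /memv_imgP[b bB ->] := memv_pick U.
by rewrite !lfunE /= !lfunE; exists b.
Qed.

(** The property applied to z, 1 - z and to 1 - z, z gives z a = z a z = a z. *)
Lemma sub_central_idempotent z : z \in B -> z * z = z ->
  (forall b, b \in B -> z * b = b * z) -> forall a, z * a = a * z.
Proof.
move=> zB zz zc a.
have z1 : z * a * (1 - z) = 0.
  apply: annB; rewrite ?rpredB // => b bB.
  by rewrite mulrBr mulr1 -mulrA -zc // mulrA zz subrr.
have z2 : (1 - z) * a * z = 0.
  apply: annB; rewrite ?rpredB // => b bB.
  by rewrite -mulrA -zc // mulrA mulrBl mul1r zz subrr mul0r.
transitivity (z * a * z).
  by apply/subr0_eq; rewrite -[RHS]z1 mulrBr mulr1.
by apply/esym/subr0_eq; rewrite -[RHS]z2 !mulrBl mul1r.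
Qed.

End Subalgebra.

Section PrimitiveIdempotent.
Variables (k : closedFieldType) (A : falgType k) (B : {aspace A}).
Hypothesis ssA : semisimple_algebra A.
Hypothesis annB : annihilation_extends B.

(** A minimal left ideal L inside the given one is generated by an idempotent p
since L x = L for some x in L, and then p x = x.  Right multiplication of L by
p b p has an eigenvalue, whose eigenspace is a left ideal, hence is L. *)
Lemma primitive_idempotent (L : {vspace A}) :
  L != 0%VS -> (L <= B)%VS -> (forall b x, b \in B -> x \in L -> b * x \in L) ->
  exists p, [/\ p \in L, p != 0, p * p = p
               & forall b, b \in B -> p * b * p \in <[p]>%VS].
Proof.
have [n] := ubnP (\dim L); elim: n L => // n IHn L; rewrite ltnS => dL L0 LB Ll.
(* Minimality of L may be assumed: a smaller nonzero left ideal settles the goal. *)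
have smaller (K : {vspace A}) : K != 0%VS -> (K <= L)%VS ->
    (forall b x, b \in B -> x \in K -> b * x \in K) ->
  K = L \/ exists p, [/\ p \in L, p != 0, p * p = p
               & forall b, b \in B -> p * b * p \in <[p]>%VS].
  move=> K0 KL Kl; have [|nKL] := eqVneq K L; [by left | right].
  have dK : (\dim K < n)%N.
    apply: leq_trans dL; rewrite ltn_neqAle dimvS // andbT.
    by apply: contraNneq nKL => dKL; rewrite eqEdim KL dKL /=.
  have [p [pK ? ? ?]] := IHn K dK K0 (subv_trans KL LB) Kl.
  by exists p; split=> //; apply: (subvP KL).
have LLB x : x \in L -> x \in B by apply: (subvP LB).
pose x0 := vpick L; have x0L : x0 \in L by apply: memv_pick.
have [b bB x0b] : exists2 b, b \in B & x0 * b * x0 != 0.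
  by apply: (semiprime_subP ssA annB); rewrite ?vpick0 // LLB.
pose x := b * x0; have xL : x \in L by apply: Ll.
have [||c y cB /memv_imgP[u uL ->]|LxL|//] := smaller (amulr x @: L)%VS.
- apply: contraNneq x0b => Lx0; rewrite -memv0 -Lx0 -mulrA.
  by apply/memv_imgP; exists x0; rewrite // lfunE.
- by apply/subvP=> _ /memv_imgP[u uL ->]; rewrite lfunE /= Ll // LLB.
- by apply/memv_imgP; exists (c * u); rewrite ?Ll // !lfunE /= mulrA.
have xI u : u \in L -> u * x = 0 -> u = 0.
  move=> uL ux0; have := limg_ker_dim (amulr x) L; rewrite LxL => /eqP.
  rewrite -[X in _ == X]add0n eqn_add2r dimv_eq0 => /eqP K0.
  by apply/eqP; rewrite -memv0 -K0 memv_cap uL memv_ker lfunE /= ux0 eqxx.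
have /memv_imgP[p pL] : x \in (amulr x @: L)%VS by rewrite LxL.
rewrite lfunE /= => px.
have pR u : u \in L -> u * p = u.
  move=> uL; apply/subr0_eq/xI; first by rewrite rpredB // Ll // LLB.
  by rewrite mulrBl -mulrA -px subrr.
have pp := pR _ pL.
have p0 : p != 0.
  by apply: contraNneq x0b => p0; rewrite -mulrA -/x px p0 mul0r mulr0.
have [pBp|/subvPn[y]] := boolP ((amulr p \o amull p)%VF @: B <= <[p]>)%VS.
  exists p; split=> //.
  move=> c cB; apply: (subvP pBp); apply/memv_imgP; exists c => //.
  by rewrite !lfunE /= !lfunE.
case/memv_imgP=> c cB; rewrite !lfunE /= !lfunE /= => yE yp.
have yL : y \in L by rewrite yE Ll // memvM // LLB.
have [|a [u [uL u0]]] := closed_eigenvector (f := amulr y) L0.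
  by apply/subvP=> _ /memv_imgP[v vL ->]; rewrite lfunE /= Ll // LLB.
rewrite lfunE /= => uy.
pose K := lker (amulr y - a *: \1%VF).
have KP v : (v \in K) = (v * y == a *: v).
  by rewrite memv_ker add_lfunE opp_lfunE scale_lfunE id_lfunE lfunE /= subr_eq0.
have [||d v dB|LK|//] := smaller (L :&: K)%VS.
- apply: contraNneq u0 => K0; rewrite -memv0 -K0 memv_cap uL KP.
  exact/eqP.
- exact: capvSl.
- rewrite !memv_cap !KP => /andP[vL /eqP vy]; rewrite Ll //=.
  by rewrite -mulrA vy -scalerAr.
case/negP: yp; move: pL; rewrite -LK memv_cap KP => /andP[_ /eqP yp].
have -> : y = p * y by rewrite yE !mulrA pp.
by rewrite yp memvZ // memv_line.
Qed.

End PrimitiveIdempotent.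

Section Blocks.
Variables (k : fieldType) (A : falgType k) (B : {aspace A}).

(** The last clause makes the span of the matrix units an ideal of B: b acts on it
from the left and from the right through one and the same matrix, that of b
times the unit of the block. *)
Record matrix_block n (E : 'I_n.+1 -> 'I_n.+1 -> A) : Prop := MatrixBlock {
  block_sub : forall i j, E i j \in B;
  block_mul : forall i j l m, E i j * E l m = (j == l)%:R *: E i m;
  block_neq0 : E ord0 ord0 != 0;
  block_act : forall b, b \in B -> exists beta : 'M[k]_n.+1,
    (forall i j, b * E i j = \sum_l beta l i *: E l j) /\
    (forall i j, E i j * b = \sum_l beta j l *: E i l)
}.

Definition block_unit n (E : 'I_n.+1 -> 'I_n.+1 -> A) := \sum_i E i i.

Variables (n : nat) (E : 'I_n.+1 -> 'I_n.+1 -> A).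
Hypothesis EB : matrix_block E.

Lemma block_mulE i j m : E i j * E j m = E i m.
Proof. by rewrite (block_mul EB) eqxx scale1r. Qed.

Lemma block_unitl i j : block_unit E * E i j = E i j.
Proof.
rewrite mulr_suml (bigD1 i) //= block_mulE big1 ?addr0 // => l /negPf li.
by rewrite (block_mul EB) li scale0r.
Qed.

Lemma block_unit_idem : block_unit E * block_unit E = block_unit E.
Proof. by rewrite {2}/block_unit mulr_sumr; under eq_bigr do rewrite block_unitl. Qed.

Lemma block_unit_sub : block_unit E \in B.
Proof. by apply: rpred_sum => i _; apply: block_sub. Qed.

Lemma block_unit_central b : b \in B -> block_unit E * b = b * block_unit E.
Proof.
move=> /(block_act EB)[beta [bE Eb]]; rewrite mulr_suml mulr_sumr.
under eq_bigr do rewrite Eb; under [RHS]eq_bigr do rewrite bE.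
by rewrite exchange_big.
Qed.

Lemma block_unit_neq0 : block_unit E != 0.
Proof.
by apply: contraNneq (block_neq0 EB) => z0; rewrite -block_unitl z0 mul0r.
Qed.

(** A linear form psi on A is made into a bimodule map by transporting a to the
corner at (0, 0) in all possible ways, as one recovers a matrix from its
entries. *)
Definition block_functional (psi : A -> k^o) (a : A) : A :=
  \sum_i \sum_j psi (E ord0 i * a * E j ord0) *: E i j.

(** The diagonal embedding of the corner algebra into the centralizer. *)
Definition block_spread (d : A) : A := \sum_l E l ord0 * d * E ord0 l.

Lemma regular_scale (c : k) (x : k^o) (v : A) : (c *: x) *: v = x *: (c *: v).
Proof. by rewrite scalerA mulrC. Qed.

Section Functional.
Variable psi : A -> k^o.
Hypothesis psil : linear psi.

Lemma block_functional_linear : linear (block_functional psi).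
Proof. by rewrite /block_functional; lin. Qed.

Lemma block_functional_sub a : block_functional psi a \in B.
Proof.
apply: rpred_sum => i _; apply: rpred_sum => j _.
by apply: rpredZ; apply: block_sub.
Qed.

Lemma block_functionalMl a b : b \in B ->
  block_functional psi (b * a) = b * block_functional psi a.
Proof.
move=> /(block_act EB)[beta [bE Eb]].
rewrite /block_functional exchange_big [in RHS]exchange_big mulr_sumr.
apply: eq_bigr => j _; rewrite mulr_sumr.
under eq_bigr => i _.
  rewrite mulrA Eb !mulr_suml lin_sum // scaler_suml.
  under eq_bigr => l _ do rewrite -!scalerAl linZ // regular_scale.
  over.
rewrite exchange_big; apply: eq_bigr => l _.
by rewrite -scalerAr bE scaler_sumr.
Qed.

Lemma block_functionalMr a b : b \in B ->
  block_functional psi (a * b) = block_functional psi a * b.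
Proof.
move=> /(block_act EB)[beta [bE Eb]].
rewrite /block_functional mulr_suml; apply: eq_bigr => i _; rewrite mulr_suml.
under eq_bigr => j _.
  rewrite -!mulrA bE !mulr_sumr lin_sum // scaler_suml.
  under eq_bigr => l _ do rewrite -!scalerAr linZ // regular_scale.
  over.
rewrite exchange_big; apply: eq_bigr => l _.
by rewrite -scalerAl Eb scaler_sumr mulrA.
Qed.

End Functional.

Lemma block_spread_linear : linear block_spread.
Proof. by rewrite /block_spread; lin. Qed.

Lemma block_spread_comm d b : b \in B -> b * block_spread d = block_spread d * b.
Proof.
move=> /(block_act EB)[beta [bE Eb]]; rewrite mulr_sumr mulr_suml.
under eq_bigr do rewrite !mulrA bE !mulr_suml.
under [RHS]eq_bigr do rewrite -mulrA Eb mulr_sumr.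
rewrite exchange_big; apply: eq_bigr => i _; apply: eq_bigr => j _.
by rewrite -!scalerAl -scalerAr.
Qed.

(** The corner element at (i, j), spread over the diagonal and multiplied by
E i j, is the component E i i a E j j. *)
Lemma block_decomp a :
  \sum_i \sum_j E i j * block_spread (E ord0 i * a * E j ord0) =
  block_unit E * a * block_unit E.
Proof.
rewrite /block_unit !mulr_suml; apply: eq_bigr => i _; rewrite mulr_sumr.
apply: eq_bigr => j _; rewrite /block_spread mulr_sumr (bigD1 j) //= big1.
  rewrite addr0 !mulrA block_mulE block_mulE -!mulrA block_mulE.
  by [].
by move=> l /negPf lj; rewrite !mulrA (block_mul EB) eq_sym lj scale0r !mul0r.
Qed.

End Blocks.

Section BlockInduction.
Variables (k : closedFieldType) (A : falgType k) (B : {aspace A}).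
Hypothesis B1 : 1 \in B.
Hypothesis ssA : semisimple_algebra A.
Hypothesis annB : annihilation_extends B.

Section DualBases.
Variable p : A.
Hypotheses (pB : p \in B) (p0 : p != 0) (pp : p * p = p).
Hypothesis pBp : forall b, b \in B -> p * b * p \in <[p]>%VS.

Let L := (amulr p @: B)%VS.
Let R := (amull p @: B)%VS.

Let LP x : reflect (x \in B /\ x * p = x) (x \in L).
Proof.
apply: (iffP memv_imgP) => [[b bB ->]|[xB xp]].
  by rewrite lfunE /= memvM // -mulrA pp.
by exists x; rewrite // lfunE.
Qed.

Let RP y : reflect (y \in B /\ p * y = y) (y \in R).
Proof.
apply: (iffP memv_imgP) => [[b bB ->]|[yB yp]].
  by rewrite lfunE /= memvM // mulrA pp.
by exists y; rewrite // lfunE.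
Qed.

Lemma corner_scalar y x : y \in R -> x \in L -> exists c, y * x = c *: p.
Proof.
move=> /RP[yB py] /LP[xB xp]; apply/vlineP.
by rewrite -py -xp mulrA -[p * y * x]mulrA pBp // memvM.
Qed.

(** If p B x = 0 with x in B p, then x B x = x p B x = 0. *)
Lemma corner_nondegl x : x \in L -> (forall y, y \in R -> y * x = 0) -> x = 0.
Proof.
move=> /LP[xB xp] Rx; apply: (semiprime_sub ssA annB) => // b bB.
have -> : x * b * x = x * (p * b * x) by rewrite !mulrA xp.
rewrite Rx ?mulr0 //.
by apply/RP; rewrite memvM // mulrA pp.
Qed.

Lemma corner_nondegr y : y \in R -> (forall x, x \in L -> y * x = 0) -> y = 0.
Proof.
move=> /RP[yB py] Ly; apply: (semiprime_sub ssA annB) => // b bB.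
have -> : y * b * y = y * (b * p) * y by rewrite -!mulrA py.
rewrite Ly ?mul0r //.
by apply/LP; rewrite memvM // -mulrA pp.
Qed.

(** By nondegeneracy the Gram matrix of the pairing between bases of p B and B p
has independent rows, and a one-sided inverse of it gives the dual family. *)
Lemma corner_dual_bases : exists n (x y : 'I_n.+1 -> A),
  [/\ basis_of L [tuple x i | i < n.+1], forall i, y i \in R
    & forall i j, y i * x j = (i == j)%:R *: p].
Proof.
have L0 : L != 0%VS.
  by apply: contraNneq p0 => L0; rewrite -memv0 -L0; apply/LP.
move: (vbasis L) (vbasisP L); case: (\dim L) => [|n] X bX.
  by case/eqP: L0; rewrite -(span_basis bX) tuple0 span_nil.
pose x (i : 'I_n.+1) := X`_i; pose m := \dim R; pose u (s : 'I_m) := (vbasis R)`_s.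
have xL i : x i \in L by apply/(basis_mem bX)/memt_nth.
have uR s : u s \in R by apply/vbasis_mem/memt_nth.
have Xx : X = [tuple x i | i < n.+1].
  by apply: eq_from_tnth => i; rewrite tnth_mktuple (tnth_nth 0).
pose lam a := coord [tuple p] ord0 a.
have lamE s j : u s * x j = lam (u s * x j) *: p.
  have [c ->] := corner_scalar (uR s) (xL j); rewrite /lam linearZ /=.
  have /= -> := coord_free ord0 ord0 (X := [tuple p]);
    last by rewrite free_cons span_nil memv0 p0 nil_free.
  by congr (_ *: p); rewrite ?eqxx; exact: esym (mulr1 c).
pose G : 'M[k]_(n.+1, m) := \matrix_(j, s) lam (u s * x j).
have /row_freeP[Y GY] : row_free G.
  apply: inj_row_free => v vG; have /freeP fX := basis_free bX.
  apply/rowP => i; rewrite mxE; apply: (fX (fun i => v 0 i)).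
  apply: corner_nondegl; first by apply: rpred_sum => j _; apply/rpredZ/xL.
  move=> y yR; rewrite (coord_vbasis yR) mulr_suml big1 // => s _.
  rewrite -scalerAl mulr_sumr (eq_bigr (fun j => (v 0 j * G j s) *: p)).
    move/rowP/(_ s): vG; rewrite !mxE -scaler_suml => ->.
    by rewrite scale0r scaler0.
  by move=> j _; rewrite -scalerAr lamE scalerA mxE.
exists n, x, (fun i => \sum_s Y s i *: u s); split; first by rewrite -Xx.
  by move=> i; apply: rpred_sum => s _; apply/rpredZ/uR.
move=> i j; rewrite mulr_suml.
move/matrixP/(_ j i): GY; rewrite !mxE eq_sym => <-; rewrite scaler_suml.
by apply: eq_bigr => s _; rewrite -scalerAl lamE scalerA mulrC mxE.
Qed.

(** The matrix units are x_i y_j for dual bases x of B p and y of p B.  The second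
part places them in the ideal B p B, so that whatever is orthogonal to p and
central in B is orthogonal to them. *)
Lemma corner_matrix_block : exists n (E : 'I_n.+1 -> 'I_n.+1 -> A),
  matrix_block B E /\ forall i j, exists x y, x \in B /\ E i j = x * p * y.
Proof.
have [n [x [y [bX yR yx]]]] := corner_dual_bases.
have xL i : x i \in L by rewrite -(tnth_mktuple x i) (basis_mem bX) // mem_tnth.
have xB i : x i \in B by have /LP[] := xL i.
have xp i : x i * p = x i by have /LP[] := xL i.
have yB i : y i \in B by have /RP[] := yR i.
have py i : p * y i = y i by have /RP[] := yR i.
have Lx v : v \in L -> exists c : 'I_n.+1 -> k, v = \sum_i c i *: x i.
  move=> /(coord_basis bX) {1}->; exists (fun i => coord [tuple x i | i < n.+1] i v).
  by apply: eq_bigr => i _; rewrite -tnth_nth tnth_mktuple.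
exists n, (fun i j => x i * y j); split; last first.
  by move=> i j; exists (x i), (y j); rewrite xp.
have xyxy i j l m : x i * y j * (x l * y m) = (j == l)%:R *: (x i * y m).
  by rewrite -mulrA [y j * _]mulrA yx -scalerAl -scalerAr py.
split=> //; first by move=> i j; rewrite memvM.
- apply: contraNneq p0 => x0y0; rewrite -[p]scale1r.
  have <- : y ord0 * x ord0 = 1 *: p by rewrite yx eqxx.
  have := congr1 (fun t => y ord0 * t * x ord0) x0y0.
  by rewrite mulr0 mul0r mulrA yx eqxx scale1r -mulrA yx eqxx scale1r pp => ->.
move=> b bB; have blP (i : 'I_n.+1) : exists c : {ffun 'I_n.+1 -> k},
    b * x i = \sum_l c l *: x l.
  have /Lx[c ->] : b * x i \in L by apply/LP; rewrite memvM // -mulrA xp.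
  by exists (finfun c); apply: eq_bigr => l _; rewrite ffunE.
have [c cE] := fin_all_exists blP.
exists (\matrix_(l, i) c i l); split=> i j.
  rewrite mulrA cE mulr_suml; apply: eq_bigr => l _.
  by rewrite mxE -scalerAl.
rewrite -mulrA; have -> : y j * b = \sum_l c l j *: y l.
  apply/subr0_eq/corner_nondegr.
    rewrite rpredB // ?rpred_sum //; last by move=> l _; apply/rpredZ/yR.
    by apply/RP; rewrite memvM // mulrA py.
  move=> _ /Lx[d ->]; rewrite mulr_sumr big1 // => i' _.
  rewrite -scalerAr mulrBl -mulrA cE mulr_sumr mulr_suml.
  rewrite (bigD1 j) //= [in X in _ - X](bigD1 i') //= !big1 ?addr0.
  - by rewrite -scalerAr -scalerAl !yx !eqxx subrr scaler0.
  - by move=> l /negPf li; rewrite -scalerAl yx li scale0r scaler0.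
  - by move=> l /negPf lj; rewrite -scalerAr yx eq_sym lj scale0r scaler0.
by rewrite mulr_sumr; apply: eq_bigr => l _; rewrite mxE -scalerAr.
Qed.
End DualBases.

(** Completeness of the block decomposition: as long as z is not 1, the nonzero
left ideal B (1 - z) contains a primitive idempotent, whose block is orthogonal
to z and makes B (1 - z) drop in dimension. *)
Lemma block_induction (P : A -> Prop) :
  P 0 ->
  (forall z n (E : 'I_n.+1 -> 'I_n.+1 -> A), z \in B -> z * z = z ->
     (forall b, b \in B -> z * b = b * z) -> matrix_block B E ->
     z * block_unit E = 0 -> P z -> P (z + block_unit E)) ->
  P 1.
Proof.
move=> P0 PE; pose L z := (amulr (1 - z) @: B)%VS.
suff claim m z : (\dim (L z) < m)%N -> z \in B -> z * z = z ->
    (forall b, b \in B -> z * b = b * z) -> P z -> P 1.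
  apply: (claim _ 0 (leqnn _)); rewrite ?mem0v ?mulr0 // => b _.
  by rewrite mulr0 mul0r.
elim: m z => // m IHm z; rewrite ltnS => dz zB zz zc Pz.
have LP u : reflect (u \in B /\ u * z = 0) (u \in L z).
  apply: (iffP memv_imgP) => [[b bB ->]|[uB uz]].
    rewrite lfunE /= memvM ?rpredB //; split=> //.
    by rewrite -mulrA mulrBl mul1r zz subrr mulr0.
  by exists u; rewrite // lfunE /= mulrBr uz subr0 mulr1.
have [<- //|z1] := eqVneq z 1.
have [||b u bB /LP[uB uz]|p [/LP[pB pz] p0 pp pBp]] :=
    primitive_idempotent ssA annB (L := L z).
- apply: contraNneq z1 => L0; rewrite eq_sym -subr_eq0 -memv0 -L0.
  by apply/LP; rewrite rpredB // mulrBl mul1r zz subrr.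
- by apply/subvP => u /LP[].
- by apply/LP; rewrite memvM // -mulrA uz mulr0.
have [n [E [EB Ep]]] := corner_matrix_block pB p0 pp pBp.
have zE : z * block_unit E = 0.
  rewrite mulr_sumr big1 // => i _; have [x [y [xB ->]]] := Ep i i.
  by rewrite !mulrA zc // -[x * z * p]mulrA zc // pz mulr0 mul0r.
have EzB := block_unit_sub EB; have Ec := block_unit_central EB.
have Ez : block_unit E * z = 0 by rewrite -zc.
have EE := block_unit_idem EB.
have LzS : (L (z + block_unit E)%R <= L z)%VS.
  apply/subvP => _ /memv_imgP[b bB ->]; rewrite lfunE /=; apply/LP.
  rewrite memvM ?rpredB ?rpredD // -mulrA mulrBl mul1r mulrDl zz Ez addr0.
  by rewrite subrr mulr0.
apply: (IHm (z + block_unit E)); last exact: PE.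
- apply: leq_trans dz; rewrite ltn_neqAle dimvS // andbT.
  apply: contraNneq (block_unit_neq0 EB) => dLL.
  have : (L (z + block_unit E)%R == L z).
    by rewrite eqEdim LzS dLL /=.
  move/eqP => LL; have : block_unit E \in L z by apply/LP.
  rewrite -LL => /memv_imgP[u _ uE]; rewrite -EE {1}uE lfunE /= -mulrA.
  by rewrite mulrBl mul1r mulrDl zE EE add0r subrr mulr0.
- exact: rpredD.
- by rewrite mulrDl !mulrDr zz zE Ez EE addr0 add0r.
- by move=> b bB; rewrite mulrDl mulrDr zc // Ec.
Qed.

End BlockInduction.

(** * Depth one through coordinates *)

Section DepthOne.
Variables (k : fieldType) (A : falgType k) (B : {aspace A}).
Hypothesis B1 : 1 \in B.

(** An element centralizing B is the image of 1 under a bimodule map from B to A,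
so each pair encodes bimodule maps from A to B and back. *)
Definition bimodule_coords (s : seq ('End(A) * A)) :=
  forall fc, fc \in s ->
  [/\ forall a, fc.1 a \in B,
      forall a b, b \in B -> fc.1 (b * a) = b * fc.1 a,
      forall a b, b \in B -> fc.1 (a * b) = fc.1 a * b
    & forall b, b \in B -> b * fc.2 = fc.2 * b].

Lemma vsval_unit : vsval (1 : subvs_of B) = 1.
Proof. by apply/eqP; rewrite -[vsval 1]/(algid B) algid_eq1. Qed.

(** The components of the embedding of A into the power of B and the images of the
standard generators under the projection back to A. *)
Lemma depth_one_coords : depth_one B ->
  exists2 s, bimodule_coords s & forall a, \sum_(fc <- s) fc.1 a * fc.2 = a.
Proof.
case=> n n0 [U [V [Ub Vb UV UV0 [f [finj fU fl fr]]]]].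
have fker : lker f == 0%VS by apply/lker0P.
pose g : 'Hom({ffun 'I_n -> subvs_of B}, A) := (f^-1 \o daddv_pi U V)%VF.
have gf a : g (f a) = a.
  by rewrite lfunE /= daddv_pi_id ?lker0_lfunK // -fU memv_img ?memvf.
have gV v : v \in V -> g v = 0.
  move=> vV; have := daddv_pi_add UV0 (w := v); rewrite UV memvf => /(_ isT).
  rewrite [daddv_pi V U v]daddv_pi_id // 1?capvC // => /eqP.
  by rewrite addrC -subr_eq0 addrAC subrr add0r lfunE /= => /eqP->; rewrite linear0.
have UVP x : exists2 u, u \in U & exists2 v, v \in V & x = u + v.
  have /memv_addP[u uU [v vV ->]] : x \in (U + V)%VS by rewrite UV memvf.
  by exists u => //; exists v.
have gl (r : subvs_of B) (x : {ffun 'I_n -> subvs_of B}) :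
    g [ffun i => r * x i] = vsval r * g x.
  have [u uU [v vV ->]] := UVP x.
  move: uU; rewrite -fU => /memv_imgP[a _ ->].
  rewrite (_ : finfun _ = f (vsval r * a) + [ffun i => r * v i]).
    by rewrite !linearD /= !gf !gV ?addr0 //; have [] := Vb r v vV.
  by rewrite fl; apply/ffunP => i; rewrite !ffunE mulrDr.
have gr (r : subvs_of B) (x : {ffun 'I_n -> subvs_of B}) :
    g [ffun i => x i * r] = g x * vsval r.
  have [u uU [v vV ->]] := UVP x.
  move: uU; rewrite -fU => /memv_imgP[a _ ->].
  rewrite (_ : finfun _ = f (a * vsval r) + [ffun i => v i * r]).
    by rewrite !linearD /= !gf !gV ?addr0 //; have [] := Vb r v vV.
  by rewrite fr; apply/ffunP => i; rewrite !ffunE mulrDl.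
pose d i : {ffun 'I_n -> subvs_of B} := [ffun j => (i == j)%:R].
have hl i : linear (fun a => vsval (f a i)).
  by move=> c a b; rewrite linearP !ffunE linearP.
pose h i := linfun (linpack (hl i)).
have hE i a : h i a = vsval (f a i) by rewrite lfunE.
exists [seq (h i, g (d i)) | i <- enum 'I_n].
  move=> _ /mapP[i _ ->] /=; split=> [a|a b bB|a b bB|b bB].
  - by rewrite hE; apply: subvsP.
  - by rewrite !hE -{1}(vsprojK bB) fl ffunE /= vsprojK.
  - by rewrite !hE -{1}(vsprojK bB) fr ffunE /= vsprojK.
  rewrite -(vsprojK bB) -gl -gr; congr (g _); apply/ffunP => j; rewrite !ffunE.
  by rewrite mulr_natl mulr_natr.
move=> a; rewrite big_map big_enum /= -[RHS]gf.
rewrite (_ : f a = \sum_i [ffun j => f a i * d i j]).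
  rewrite linear_sum; apply: eq_bigr => i _.
  by rewrite hE -gl.
apply/ffunP => j; rewrite sum_ffunE (bigD1 j) //= big1 ?addr0.
  by rewrite !ffunE eqxx mulr1.
by move=> i /negPf ij; rewrite !ffunE ij mulr0.
Qed.

(** The coordinates embed A into a power of B, and the combinations of the
centralizing elements split this embedding; n > 0 because A is nonzero. *)
Lemma coords_depth_one s : bimodule_coords s ->
  (forall a, \sum_(fc <- s) fc.1 a * fc.2 = a) -> depth_one B.
Proof.
move=> sP sE; pose n := size s; pose f (i : 'I_n) := (tnth (in_tuple s) i).1.
pose c (i : 'I_n) := (tnth (in_tuple s) i).2.
have sP' i := sP _ (mem_tnth i (in_tuple s)).
have fB i a : f i a \in B by have [] := sP' i.
have fl i a b : b \in B -> f i (b * a) = b * f i a by have [_ + _ _] := sP' i; apply.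
have fr i a b : b \in B -> f i (a * b) = f i a * b by have [_ _ + _] := sP' i; apply.
have cC i b : b \in B -> b * c i = c i * b by have [_ _ _ +] := sP' i; apply.
have fcE a : \sum_i f i a * c i = a.
  by rewrite -[RHS]sE [RHS](big_tuple _ _ (in_tuple s)).
have n0 : (0 < n)%N.
  rewrite lt0n; apply/negP => /eqP s0; have /eqP[] := oner_neq0 A.
  by rewrite -(fcE 1) big1 // => i; have := ltn_ord i; rewrite {2}s0.
exists n => //.
have Fl : linear (fun a => [ffun i => vsproj B (f i a)] : {ffun 'I_n -> subvs_of B}).
  by move=> r a b; apply/ffunP => i; rewrite !ffunE !linearP.
have Gl : linear (fun x : {ffun 'I_n -> subvs_of B} => \sum_i vsval (x i) * c i).
  move=> r x y; rewrite scaler_sumr -big_split; apply: eq_bigr => i _ /=.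
  by rewrite !ffunE linearP mulrDl scalerAl.
pose F := linfun (linpack Fl); pose G := linfun (linpack Gl).
have GF a : G (F a) = a.
  rewrite !lfunE /= -[RHS]fcE; apply: eq_bigr => i _.
  by rewrite ffunE vsprojK.
exists (limg F), (lker G); split.
- move=> r _ /memv_imgP[a _ ->]; split; apply/memv_imgP.
    exists (vsval r * a); rewrite ?memvf // !lfunE; apply/ffunP => i.
    rewrite !ffunE /= fl ?subvsP //.
    by apply: val_inj; rewrite /= !vsprojK ?memvM ?subvsP.
  exists (a * vsval r); rewrite ?memvf // !lfunE; apply/ffunP => i.
  rewrite !ffunE /= fr ?subvsP //.
  by apply: val_inj; rewrite /= !vsprojK ?memvM ?subvsP.
- move=> r x; rewrite !memv_ker !lfunE /= => /eqP x0; split; apply/eqP.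
    under eq_bigr => i _ do rewrite ffunE /= -mulrA.
    by rewrite -mulr_sumr x0 mulr0.
  under eq_bigr => i _ do rewrite ffunE /= -mulrA cC ?subvsP // mulrA.
  by rewrite -mulr_suml x0 mul0r.
- apply/eqP; rewrite eqEsubv subvf; apply/subvP => x _.
  rewrite -[x](subrK (F (G x))) addrC memv_add ?memv_img ?memvf //.
  by rewrite memv_ker linearB /= GF subrr.
- apply/eqP; rewrite -subv0; apply/subvP => x; rewrite memv_cap memv_ker memv0.
  by case/andP => /memv_imgP[a _ ->]; rewrite GF => /eqP->; rewrite linear0.
exists F; split=> //.
- by apply: can_inj GF.
- move=> r a; rewrite !lfunE; apply/ffunP => i; rewrite !ffunE /= fl ?subvsP //.
  by apply: val_inj; rewrite /= !vsprojK ?memvM ?subvsP.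
move=> r a; rewrite !lfunE; apply/ffunP => i; rewrite !ffunE /= fr ?subvsP //.
by apply: val_inj; rewrite /= !vsprojK ?memvM ?subvsP.
Qed.

Lemma coords_annihilation s : bimodule_coords s ->
  (forall a, \sum_(fc <- s) fc.1 a * fc.2 = a) -> annihilation_extends B.
Proof.
move=> sP sE c d cB dB cBd a; rewrite -(sE a) mulr_sumr mulr_suml big_seq.
rewrite big1 // => fc fcs; have [fB _ _ fC] := sP _ fcs.
by rewrite -mulrA -[_ * d]mulrA -fC // !mulrA cBd // mul0r.
Qed.

(** Coordinates of the summand of a block are the maps attached to the coordinate
forms of a basis of A, paired with the spread of that basis. *)
Lemma block_coords z n (E : 'I_n.+1 -> 'I_n.+1 -> A) s :
  matrix_block B E -> (forall a, block_unit E * a = a * block_unit E) ->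
  bimodule_coords s -> (forall a, \sum_(fc <- s) fc.1 a * fc.2 = a * z) ->
  exists2 s', bimodule_coords s' &
    forall a, \sum_(fc <- s') fc.1 a * fc.2 = a * (z + block_unit E).
Proof.
move=> EB Ec sP sE; pose N := \dim {:A}.
pose phi (i : 'I_N) : A -> k^o := coord (vbasis {:A}) i.
have phil i : linear (phi i) by apply: linearP.
pose f i := linfun (linpack (block_functional_linear E (phil i))).
have fE i a : f i a = block_functional E (phi i) a by rewrite lfunE.
exists (s ++ [seq (f i, block_spread E (vbasis {:A})`_i) | i <- enum 'I_N]).
  move=> fc; rewrite mem_cat => /orP[/sP //|/mapP[i _ ->]] /=.
  split=> [a|a b bB|a b bB|b bB]; rewrite ?fE.
  - exact: block_functional_sub EB _ _.
  - exact: (block_functionalMl EB (phil i) _ bB).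
  - exact: (block_functionalMr EB (phil i) _ bB).
  - exact: (block_spread_comm EB _ bB).
move=> a; rewrite big_cat big_map big_enum /= sE mulrDr; congr (_ + _).
rewrite -[in RHS](block_unit_idem EB) mulrA -(Ec a) -(block_decomp EB).
under eq_bigr do rewrite fE /block_functional mulr_suml.
rewrite exchange_big; apply: eq_bigr => i _ /=.
under eq_bigr do rewrite mulr_suml.
rewrite exchange_big; apply: eq_bigr => j _ /=.
rewrite [in RHS](coord_vbasis (memvf (E ord0 i * a * E j ord0))).
rewrite (lin_sum _ _ _ (block_spread_linear E)) mulr_sumr.
apply: eq_big => // l _; rewrite (linZ _ _ (block_spread_linear E)).
by rewrite -scalerAl -scalerAr.
Qed.

End DepthOne.

Lemma annihilation_depth_one (k : closedFieldType) (A : falgType k)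
    (B : {aspace A}) : 1 \in B -> semisimple_algebra A ->
  annihilation_extends B -> depth_one B.
Proof.
move=> B1 ssA annB.
have [s sP sE] : exists2 s, bimodule_coords B s &
    forall a, \sum_(fc <- s) fc.1 a * fc.2 = a * 1.
  apply: (block_induction B1 ssA annB (P := fun z => exists2 s, bimodule_coords B s &
    forall a, \sum_(fc <- s) fc.1 a * fc.2 = a * z)).
    by exists [::] => // a; rewrite big_nil mulr0.
  move=> z n E _ _ _ EB _ [s sP sE]; apply: block_coords sP sE => //.
  apply: sub_central_idempotent annB _ (block_unit_sub EB) (block_unit_idem EB) _ => //.
  exact: block_unit_central.
by apply: (coords_depth_one sP) => a; rewrite sE mulr1.
Qed.

(** * Integrals of a semisimple Hopf algebra, normality, annihilation *)

Section SemisimpleHopf.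
Variables (k : fieldType) (A : hopfAlgType k).
Hypothesis ssA : semisimple_algebra A.

(** A left ideal complementary to the kernel of the counit supplies a left integral
Lambda of counit 1.  It is also a right integral: Lambda a minus counit(a) Lambda
is a left integral of counit 0, so it spans a left ideal of square zero. *)
Lemma semisimple_integral : exists Lambda : A,
  [/\ counit Lambda = 1, forall a, a * Lambda = counit a *: Lambda
    & forall a, Lambda * a = counit a *: Lambda].
Proof.
pose U := lker (linfun (counit : A -> k^o)).
have UP x : (x \in U) = (counit x == 0) by rewrite memv_ker lfunE.
have [r u|V [Vl UV UV0]] := left_ideal_complement ssA (U := U).
  by rewrite !UP counitM => /eqP->; rewrite mulr0.
have /memv_addP[u uU [v vV uv1]] : 1 \in (U + V)%VS by rewrite UV memvf.
have v1 : counit v = 1.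
  by rewrite -(counit1 (s := A)) uv1 linearD /=;
    move: uU; rewrite UP => /eqP->; rewrite add0r.
have vl a : a * v = counit a *: v.
  apply/subr0_eq/eqP; rewrite -memv0 -UV0 memv_cap UP linearB linearZ /= counitM v1.
  by rewrite !mulr1 subrr eqxx rpredB // ?rpredZ // Vl.
exists v; split=> // a; pose x := v * a - counit a *: v.
have xl r : r * x = counit r *: x.
  by rewrite mulrBr mulrA vl -scalerAr vl -scalerAl scalerBr !scalerA mulrC.
have x0 : counit x = 0.
  rewrite linearB linearZ /= counitM v1 mul1r.
  by rewrite mulr1 subrr.
apply/subr0_eq; apply: (nil_left_ideal0 ssA (U := <[x]>%VS)); last exact: memv_line.
  by move=> r _ /vlineP[c ->]; rewrite -scalerAr xl scalerA memvZ // memv_line.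
move=> _ _ /vlineP[c ->] /vlineP[d ->].
by rewrite -scalerAl -scalerAr xl x0 scale0r !scaler0.
Qed.

Variable B : {aspace A}.
Hypothesis hB : hopf_subalgebra B.

(** Since the counit of Lambda is 1, some coordinate of Lambda has nonzero counit;
its normalization e is an integral of B, and it is central in A because the
coordinates of a lie in B and the other factors centralize B. *)
Lemma depth_one_normal : depth_one B -> normal_hopf B.
Proof.
move=> /depth_one_coords[s sP sE].
have [La [La1 Lal Lar]] := semisimple_integral.
have [/allP s0|/allPn[fc fcs e0]] :=
  boolP (all (fun fc : 'End(A) * A => counit (fc.1 La) == 0) s).
  case/eqP: (oner_neq0 k); rewrite -La1 -(sE La) linear_sum big_seq big1 // => fc fcs.
  by rewrite /= counitM (eqP (s0 _ fcs)) mul0r.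
have [fB fl fr _] := sP _ fcs.
pose e := (counit (fc.1 La))^-1 *: fc.1 La.
have eB : e \in B by rewrite rpredZ.
have el b : b \in B -> b * e = counit b *: e.
  by move=> bB; rewrite -scalerAr -fl // Lal linearZ /= !scalerA mulrC.
have er b : b \in B -> e * b = counit b *: e.
  by move=> bB; rewrite -scalerAl -fr // Lar linearZ /= !scalerA mulrC.
apply: (central_integral_normal hB eB) => //.
  by rewrite linearZ /=; apply: mulVf.
move=> a; rewrite -(sE a) mulr_suml mulr_sumr !big_seq; apply: eq_bigr => gd gds.
have [gB _ _ gC] := sP _ gds.
by rewrite -mulrA -gC // !mulrA el // er.
Qed.

(** The element c kills B d, hence the twisted product of the regular comodule with
B d; the multiplication map then sends c (a (x) d) = 0 to c a d. *)
Lemma trivial_action_annihilation :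
  normal_hopf B -> acts_trivially B -> annihilation_extends B.
Proof.
move=> nB tB c d cB dB cBd a.
pose L := (amulr d @: B)%VS.
have LP u : u \in L -> exists2 b, b \in B & u = b * d.
  by case/memv_imgP => b bB ->; exists b; rewrite // lfunE.
have LB b : b \in B -> b * d \in L.
  by move=> bB; apply/memv_imgP; exists b; rewrite ?lfunE.
have Ll b u : b \in B -> u \in L -> b * u \in L.
  by move=> bB /LP[b' b'B ->]; rewrite mulrA LB // memvM.
pose act (b : subvs_of B) (m : subvs_of L) := vsproj L (vsval b * vsval m).
have actE b m : vsval (act b m) = vsval b * vsval m.
  by rewrite vsprojK // Ll ?subvsP.
have actP : is_lmodule act.
  split=> [m x r s|r x m m'|m|r s m]; apply: val_inj; rewrite /= ?actE.
  - by rewrite !linearP /= mulrDl scalerAl.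
  - by rewrite !linearP /= mulrDr scalerAr.
  - by rewrite vsval_unit ?mul1r // hopf_sub1.
  - by rewrite mulrA.
have [f fbij fE] := tB A comul (regular_rcomodule A) _ _ actP.
pose m := vsproj L d; have mE : vsval m = d.
  by rewrite vsprojK // -[d]mul1r LB // hopf_sub1.
have act0 u : act (vsproj B c) u = 0.
  apply: val_inj; rewrite /= actE vsprojK //.
  by have [b bB ->] := LP _ (subvsP u); rewrite mulrA cBd.
have tw0 : twisted_act comul act (vsproj B c) (ptens a m) = 0.
  apply: (bij_inj fbij); rewrite fE linear0; apply/ffunP => i.
  by rewrite !ffunE act0.
have actb : bilinear_map act by split; [exact: lmodule_linl actP
  | exact: lmodule_linr actP].
have vBl : linear (vsproj B) by apply: linearP.
have adrb := bilinear_adr A.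
move: tw0; rewrite /twisted_act tliftE; [|by move=> ?; lin..].
move/(congr1 (tlift (fun x (u : subvs_of L) => x * vsval u))).
rewrite (lin_tlift _ _ (tlift_is_linear _)) [RHS]lin0; last exact: tlift_is_linear.
have vl : linear (vsval : subvs_of L -> A) by apply: linearP.
under eq_tlift => x y.
  rewrite tliftE; [|by move=> ?; lin..].
  rewrite actE vsprojK ?mE; last by have [] := nB y _ (subvsP (vsproj B c)).
  rewrite vsprojK // mulrA; over.
by rewrite -(lin_tlift (g := fun u => u * d)) ?adr_mulK //; lin.
Qed.

End SemisimpleHopf.

(** * Modules over the blocks and the twisted action *)

Lemma eq_dim_iso (k : fieldType) (U T : vectType k) (V : {vspace U})
    (W : {vspace T}) : \dim V = \dim W ->
  exists (h : 'Hom(U, T)) (h' : 'Hom(T, U)),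
  [/\ forall u, h u \in W, forall t, h' t \in V,
      forall u, u \in V -> h' (h u) = u & forall t, t \in W -> h (h' t) = t].
Proof.
move=> VW; move: (vbasis V) (vbasisP V) (vbasis W) (vbasisP W).
rewrite VW; move: (\dim W) => d X bX Y bY.
have XV (i : 'I_d) : X`_i \in V by apply/(basis_mem bX)/memt_nth.
have YW (i : 'I_d) : Y`_i \in W by apply/(basis_mem bY)/memt_nth.
have hl : linear (fun u => \sum_(i < d) coord X i u *: Y`_i).
  by move=> a u v; rewrite scaler_sumr -big_split; apply: eq_bigr => i _;
     rewrite linearP scalerDl scalerA.
have h'l : linear (fun t => \sum_(i < d) coord Y i t *: X`_i).
  by move=> a u v; rewrite scaler_sumr -big_split; apply: eq_bigr => i _;
     rewrite linearP scalerDl scalerA.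
have fX := basis_free bX; have fY := basis_free bY.
exists (linfun (linpack hl)), (linfun (linpack h'l)); split.
- by move=> u; rewrite lfunE /=; apply: rpred_sum => i _; apply: rpredZ.
- by move=> u; rewrite lfunE /=; apply: rpred_sum => i _; apply: rpredZ.
- move=> u uV; rewrite !lfunE /= [RHS](coord_basis bX uV); apply: eq_bigr => i _.
  by rewrite coord_sum_free.
- move=> u uV; rewrite !lfunE /= [RHS](coord_basis bY uV); apply: eq_bigr => i _.
  by rewrite coord_sum_free.
Qed.

Section BlockModule.
Variables (k : fieldType) (A : falgType k) (B : {aspace A}).
Hypothesis B1 : 1 \in B.

Section Operators.
Variables (U : vectType k) (act : subvs_of B -> U -> U).
Hypothesis actP : is_lmodule act.

(** The action is extended to all of A through the projection onto B, so that
matrix units, which are elements of A, act directly. *)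
Definition module_op (b : A) : 'End(U) :=
  linfun (linpack (lmodule_linr actP (vsproj B b))).

Lemma module_opE b u : module_op b u = act (vsproj B b) u.
Proof. by rewrite lfunE. Qed.

Lemma module_op_val (b : subvs_of B) u : module_op (vsval b) u = act b u.
Proof. by rewrite module_opE vsvalK. Qed.

Lemma module_op1 u : module_op 1 u = u.
Proof. by rewrite -[in LHS](vsval_unit B1) module_op_val lmodule_1. Qed.

Lemma module_opM a b u : a \in B -> b \in B ->
  module_op (a * b) u = module_op a (module_op b u).
Proof.
move=> aB bB; rewrite -{1}(vsprojK aB) -{1}(vsprojK bB).
rewrite -[_ * _]/(vsval (vsproj B a * vsproj B b)) module_op_val.
by rewrite (lmodule_M actP) !module_opE.
Qed.

Lemma module_op_linear u : linear (module_op^~ u).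
Proof.
move=> c a b; rewrite !module_opE linearP.
exact: lmodule_linl actP _ _ _ _.
Qed.

End Operators.

Variables (n : nat) (E : 'I_n.+1 -> 'I_n.+1 -> A).
Hypothesis EB : matrix_block B E.
Let EinB := block_sub EB.

(** The unit of the block acts as a sum of the orthogonal idempotents E i i, all of
which have images of the same dimension. *)
Lemma block_dim (U : vectType k) (act : subvs_of B -> U -> U)
    (actP : is_lmodule act) :
  \dim (limg (module_op actP (block_unit E))) =
  (n.+1 * \dim (limg (module_op actP (E ord0 ord0))))%N.
Proof.
set op := module_op actP.
have opM i j l m u : op (E i j) (op (E l m) u) = op (E i j * E l m) u.
  by rewrite /op module_opM.
have opE i j m u : op (E i j) (op (E j m) u) = op (E i m) u.
  by rewrite opM (block_mulE EB).
have dimE i j : (\dim (limg (op (E i i))) <= \dim (limg (op (E j j))))%N.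
  rewrite -(limg_ker_dim (op (E i j)) (limg (op (E j j)))).
  apply: leq_trans (leq_addl _ _); apply: dimvS; apply/subvP => _ /memv_imgP[u _ ->].
  rewrite -(opE i j i) -(opE j j i); apply/memv_img/memv_img/memvf.
have zE u : op (block_unit E) u = \sum_i op (E i i) u.
  by rewrite (lin_sum _ _ _ (module_op_linear actP u)).
have -> : limg (op (block_unit E)) = (\sum_i limg (op (E i i)))%VS.
  apply/eqP; rewrite eqEsubv; apply/andP; split.
    apply/subvP => _ /memv_imgP[u _ ->]; rewrite zE.
    by apply: memv_sumr => i _; apply/memv_img/memvf.
  apply/subv_sumP => i _; apply/subvP => _ /memv_imgP[u _ ->].
  apply/memv_imgP; exists (op (E i i) u); rewrite ?memvf // /op -module_opM //.
    by rewrite (block_unitl EB).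
  exact: block_unit_sub EB.
have dx : directv (\sum_i limg (op (E i i)))%VS.
  apply/directv_sum_independent => u uE u0 i _.
  have uEE j : op (E j j) (u j) = u j.
    by have /memv_imgP[v _ ->] := uE j isT; rewrite opE.
  have : op (E i i) (\sum_j u j) = 0 by rewrite u0 linear0.
  rewrite linear_sum (bigD1 i) //= big1 ?addr0 ?uEE // => j /negPf ji.
  rewrite -uEE opM (block_mul EB) eq_sym ji scale0r.
  exact: lin0 (module_op_linear actP _).
rewrite (directvP dx) /= (eq_bigr (fun=> \dim (limg (op (E ord0 ord0))))).
  by rewrite sum_nat_const card_ord.
by move=> i _; apply/eqP; rewrite eqn_leq !dimE.
Qed.

(** Morita equivalence for one block: a linear map h between the images of E 0 0
extends to a B-linear map between the images of the block unit. *)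
Section Transport.
Variables (U T : vectType k).
Variables (aU : subvs_of B -> U -> U) (aT : subvs_of B -> T -> T).
Hypotheses (UP : is_lmodule aU) (TP : is_lmodule aT).

Definition block_transport (h : 'Hom(U, T)) : 'Hom(U, T) :=
  (\sum_i (module_op TP (E i ord0) \o h \o module_op UP (E ord0 i)))%VF.

Lemma block_transportE h u : block_transport h u =
  \sum_i module_op TP (E i ord0) (h (module_op UP (E ord0 i) u)).
Proof.
rewrite /block_transport sum_lfunE; apply: eq_bigr => i _.
by rewrite !comp_lfunE.
Qed.

Lemma block_transportZ h b u : b \in B ->
  block_transport h (module_op UP b u) = module_op TP b (block_transport h u).
Proof.
move=> bB; have [beta [bE Eb]] := block_act EB bB.
rewrite !block_transportE linear_sum /=.
under eq_bigr => i _.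
  rewrite -module_opM // Eb (lin_sum _ _ _ (module_op_linear UP u)) !linear_sum /=.
  under eq_bigr => l _ do rewrite (linZ _ _ (module_op_linear UP u)) !linearZ /=.
  over.
rewrite exchange_big; apply: eq_bigr => l _.
rewrite -module_opM // bE (lin_sum _ _ _ (module_op_linear TP _)).
by apply: eq_bigr => i _; rewrite (linZ _ _ (module_op_linear TP _)).
Qed.

End Transport.

Lemma block_transportK (U T : vectType k) (aU : subvs_of B -> U -> U)
    (aT : subvs_of B -> T -> T) (UP : is_lmodule aU) (TP : is_lmodule aT)
    (h : 'Hom(U, T)) (h' : 'Hom(T, U)) :
  (forall u, h u \in limg (module_op TP (E ord0 ord0))) ->
  (forall u, u \in limg (module_op UP (E ord0 ord0)) -> h' (h u) = u) ->
  forall u, block_transport TP UP h' (block_transport UP TP h u) =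
    module_op UP (block_unit E) u.
Proof.
move=> hT h'h u; rewrite !block_transportE.
rewrite (lin_sum _ _ _ (module_op_linear UP u)); apply: eq_bigr => i _.
rewrite linear_sum (bigD1 i) //= big1 ?addr0.
  rewrite -module_opM // (block_mulE EB).
  have /memv_imgP[t _ hE] := hT (module_op UP (E ord0 i) u).
  rewrite {1}hE -module_opM // (block_mulE EB) -hE h'h.
    by rewrite -module_opM // (block_mulE EB).
  by rewrite -(block_mulE EB ord0 ord0 i) module_opM // memv_img ?memvf.
move=> j /negPf ji; rewrite -module_opM // (block_mul EB) eq_sym ji scale0r.
exact: lin0 (module_op_linear TP _).
Qed.

Lemma block_modules_iso (U T : vectType k) (aU : subvs_of B -> U -> U)
    (aT : subvs_of B -> T -> T) (UP : is_lmodule aU) (TP : is_lmodule aT) :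
  \dim (limg (module_op UP (block_unit E))) =
    \dim (limg (module_op TP (block_unit E))) ->
  exists (f : 'Hom(U, T)) (g : 'Hom(T, U)),
  [/\ forall b u, b \in B -> f (module_op UP b u) = module_op TP b (f u),
      forall b t, b \in B -> g (module_op TP b t) = module_op UP b (g t),
      forall u, g (f u) = module_op UP (block_unit E) u
    & forall t, f (g t) = module_op TP (block_unit E) t].
Proof.
rewrite !block_dim => /eqP; rewrite eqn_pmul2l // => /eqP dUT.
have [h [h' [hT h'U h'h hh']]] := eq_dim_iso dUT.
exists (block_transport UP TP h), (block_transport TP UP h'); split.
- by move=> b u; apply: block_transportZ.
- by move=> b u; apply: block_transportZ.
- exact: block_transportK.
- exact: block_transportK.
Qed.

End BlockModule.

(** For a central idempotent z of B this makes the pieces z U and z T isomorphic;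
maps defined on all of U and T spare the use of these pieces as modules. *)
Definition partial_iso (k : fieldType) (A : falgType k) (B : {aspace A})
    (U T : vectType k) (aU : subvs_of B -> U -> U) (aT : subvs_of B -> T -> T)
    (UP : is_lmodule aU) (TP : is_lmodule aT) (z : A) :=
  exists (f : 'Hom(U, T)) (g : 'Hom(T, U)),
  [/\ forall b u, b \in B -> f (module_op UP b u) = module_op TP b (f u),
      forall b t, b \in B -> g (module_op TP b t) = module_op UP b (g t),
      forall u, g (f u) = module_op UP z u
    & forall t, f (g t) = module_op TP z t].

Lemma partial_isoD (k : fieldType) (A : falgType k) (B : {aspace A})
    (U T : vectType k) (aU : subvs_of B -> U -> U) (aT : subvs_of B -> T -> T)
    (UP : is_lmodule aU) (TP : is_lmodule aT) (z y : A) :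
  z \in B -> y \in B -> z * z = z -> y * y = y -> z * y = 0 ->
  (forall b, b \in B -> z * b = b * z) -> (forall b, b \in B -> y * b = b * y) ->
  partial_iso UP TP z -> partial_iso UP TP y -> partial_iso UP TP (z + y).
Proof.
move=> zB yB zz yy zy zc yc [f [g [fZ gZ gf fg]]] [f' [g' [f'Z g'Z g'f' f'g']]].
have yz : y * z = 0 by rewrite yc.
pose F := ((f \o module_op UP z) + (f' \o module_op UP y))%VF.
pose G := ((g \o module_op TP z) + (g' \o module_op TP y))%VF.
have FE u : F u = f (module_op UP z u) + f' (module_op UP y u).
  by rewrite add_lfunE !comp_lfunE.
have GE t : G t = g (module_op TP z t) + g' (module_op TP y t).
  by rewrite add_lfunE !comp_lfunE.
have op0 (X : vectType k) (aX : subvs_of B -> X -> X) (XP : is_lmodule aX) x :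
    module_op XP 0 x = 0.
  exact: lin0 (module_op_linear XP x).
exists F, G; split.
- move=> b u bB; rewrite !FE linearD /= -fZ // -f'Z // -!module_opM //.
  by rewrite zc // yc.
- move=> b t bB; rewrite !GE linearD /= -gZ // -g'Z // -!module_opM //.
  by rewrite zc // yc.
- move=> u; rewrite FE GE !linearD /= -!fZ // -!f'Z // -!module_opM //.
  rewrite zz yy zy yz !op0 !linear0 add0r addr0 gf g'f' -!module_opM //.
  by rewrite zz yy (linD _ _ (module_op_linear UP u)).
move=> t; rewrite GE FE !linearD /= -!gZ // -!g'Z // -!module_opM //.
rewrite zz yy zy yz !op0 !linear0 add0r addr0 fg f'g' -!module_opM //.
by rewrite zz yy (linD _ _ (module_op_linear TP t)).
Qed.

(** The map kappa is only linear; commuting with the block units, it equates the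
dimensions of the pieces they cut out, and these determine the pieces. *)
Lemma lmodule_iso_of_blocks (k : closedFieldType) (A : falgType k)
    (B : {aspace A}) (U T : vectType k) (aU : subvs_of B -> U -> U)
    (aT : subvs_of B -> T -> T) (UP : is_lmodule aU) (TP : is_lmodule aT)
    (kappa : 'Hom(U, T)) :
  1 \in B -> semisimple_algebra A -> annihilation_extends B ->
  bijective kappa ->
  (forall z, z \in B -> (forall a, z * a = a * z) ->
     forall u, kappa (module_op UP z u) = module_op TP z (kappa u)) ->
  lmodule_iso aU aT.
Proof.
move=> B1 ssA annB [kappa' kK Kk] kz.
have [f [g [fZ gZ gf fg]]] : partial_iso UP TP 1.
  apply: (block_induction B1 ssA annB).
    exists 0, 0; split=> [b u bB|b t bB|u|t]; rewrite !zero_lfunE ?linear0 //.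
      by rewrite (lin0 (module_op_linear UP u)).
    by rewrite (lin0 (module_op_linear TP t)).
  move=> z n E zB zz zc EB zE zP.
  have EinB := block_unit_sub EB; have EE := block_unit_idem EB.
  have Ec := sub_central_idempotent B1 annB EinB EE (block_unit_central EB).
  apply: partial_isoD => //; apply: (block_modules_iso EB).
  rewrite -(limg_dim_eq (f := kappa) (U := limg (module_op UP (block_unit E)))).
    congr (\dim _); apply/eqP; rewrite eqEsubv; apply/andP; split; apply/subvP.
      move=> _ /memv_imgP[_ /memv_imgP[u _ ->] ->].
      by rewrite kz // memv_img ?memvf.
    move=> _ /memv_imgP[t _ ->]; rewrite -(Kk t) -kz //.
    by rewrite !memv_img ?memvf.
  apply/eqP; rewrite -subv0; apply/subvP => u; rewrite memv_cap memv_ker memv0.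
  by case/andP => _ /eqP ku; rewrite -(kK u) ku -(kK 0) linear0.
exists f.
  exists g => x; [rewrite gf | rewrite fg]; exact: module_op1.
by move=> r u; rewrite -!module_op_val fZ ?subvsP.
Qed.

Section TwistedModule.
Variables (k : fieldType) (A : hopfAlgType k) (B : {aspace A}).
Hypotheses (B1 : 1 \in B) (nB : normal_hopf B).
Variables (W : vectType k) (rho : 'Hom(W, tens W A)).
Hypothesis rhoP : is_rcomodule rho.
Variables (M : vectType k) (act : subvs_of B -> M -> M).
Hypothesis actP : is_lmodule act.

Let actb : bilinear_map act := conj (lmodule_linl actP) (lmodule_linr actP).
Let vBl : linear (vsproj B). Proof. exact: linearP. Qed.
Let vl : linear (vsval : subvs_of B -> A). Proof. exact: linearP. Qed.
Let adrb := bilinear_adr A.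

Lemma twisted_act_linear b : linear (twisted_act rho act b).
Proof. exact: tlift_is_linear. Qed.

Lemma twisted_actE b w m : twisted_act rho act b (ptens w m) =
  tlift (fun w0 x => ptens w0 (act (vsproj B (adr x (vsval b))) m)) (rho w).
Proof. by rewrite /twisted_act tliftE // => ?; lin. Qed.

Lemma vsproj_adr x b : b \in B -> vsval (vsproj B (adr x b)) = adr x b.
Proof. by move=> bB; rewrite vsprojK //; have [] := nB x bB. Qed.

(** Compatibility with products is adr a (b c) = adr a_1 b * adr a_2 c together with
coassociativity of the coaction. *)
Lemma twisted_lmodule : is_lmodule (twisted_act rho act).
Proof.
split.
- by move=> t; rewrite /twisted_act; lin.
- exact: twisted_act_linear.
- move=> t; rewrite -[RHS]tens_decomp; apply: eq_tlift => w m.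
  rewrite (vsval_unit B1) -[in RHS](coact_counit rhoP w).
  rewrite (lin_tlift (g := fun w => ptens w m)); last by lin.
  apply: eq_tlift => w0 x.
  rewrite adr1 linearZ /= (linZ _ _ (actb.1 m)) -[X in vsproj B X](vsval_unit B1).
  rewrite vsvalK lmodule_1 // (linZ (g := fun u => ptens w0 u)); last by lin.
  by rewrite (linZ (g := fun u => ptens u m)) //; lin.
move=> r s t; rewrite {3}/twisted_act (lin_tlift _ _ (twisted_act_linear r)).
apply: eq_tlift => w m; rewrite (lin_tlift _ _ (twisted_act_linear r)).
under [RHS]eq_tlift => w' x do rewrite twisted_actE.
pose F (w0 : W) (x y : A) := ptens w0
   (act (vsproj B (adr x (vsval r))) (act (vsproj B (adr y (vsval s))) m)).
rewrite -(coact_coassoc (F := F)) //; last by rewrite /F; split=> ? ? /=; lin.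
apply: eq_tlift => w0 x.
rewrite /F -(lin_tlift (g := fun u => ptens w0 u)); last by lin.
congr (ptens _ _); rewrite adrM (lin_tlift _ _ vBl) (lin_tlift _ _ (actb.1 m)).
apply: eq_tlift => y z; rewrite -(lmodule_M actP); congr (act _ m).
apply: val_inj; rewrite /= !vsproj_adr ?subvsP // vsprojK // memvM //.
  by have [] := nB y (subvsP r).
by have [] := nB z (subvsP s).
Qed.

Lemma twisted_act_central z t : z \in B -> (forall a, z * a = a * z) ->
  twisted_act rho act (vsproj B z) t =
  tlift (fun w m => ptens w (act (vsproj B z) m)) t.
Proof.
move=> zB zc; apply: eq_tlift => w m.
rewrite -[in RHS](coact_counit rhoP w).
rewrite (lin_tlift (g := fun w => ptens w (act (vsproj B z) m))); last by lin.
apply: eq_tlift => w0 x; rewrite vsprojK // adr_central // linearZ /=.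
rewrite (linZ _ _ (actb.1 m)) (linZ (g := fun u => ptens w0 u)); last by lin.
by rewrite (linZ (g := fun u => ptens u _)) //; lin.
Qed.

End TwistedModule.

Lemma power_lmodule (k : fieldType) (R : falgType k) (n : nat) (M : vectType k)
  (act : R -> M -> M) : is_lmodule act -> is_lmodule (lmodule_power (n := n) act).
Proof.
move=> [al ar a1 aM]; split=> [u c r s|r c u v|u|r s u]; apply/ffunP => i.
- by rewrite !ffunE al.
- by rewrite !ffunE ar.
- by rewrite !ffunE a1.
- by rewrite !ffunE aM.
Qed.

Section TensorCoordinates.
Variables (k : fieldType) (W M : vectType k).

Lemma tens_coords_linear : linear (fun t : tens W M =>
  tlift (fun w m => [ffun i => coord (vbasis {:W}) i w *: m]) t
  : {ffun 'I_(\dim {:W}) -> M}).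
Proof. exact: tlift_is_linear. Qed.

Definition tens_coords := linfun (linpack tens_coords_linear).

Lemma tens_coordsE w m :
  tens_coords (ptens w m) = [ffun i => coord (vbasis {:W}) i w *: m].
Proof.
rewrite lfunE /= tliftE // => [u c v v'|u c v v'];
  by apply/ffunP => i; rewrite !ffunE ?linearP //= scalerDl scalerA.
Qed.

Lemma tens_coords_bij : bijective tens_coords.
Proof.
exists (fun x : {ffun 'I_(\dim {:W}) -> M} =>
  \sum_(i < \dim {:W}) ptens (vbasis {:W})`_i (x i)).
  move=> t; have gl : linear (fun x : {ffun 'I_(\dim {:W}) -> M} =>
      \sum_(i < \dim {:W}) ptens (vbasis {:W})`_i (x i)).
    move=> c x y; rewrite scaler_sumr -big_split; apply: eq_bigr => i _.
    by rewrite !ffunE (@lin_ptensr k M W M _ id).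
  rewrite lfunE /= (lin_tlift _ _ gl) -[RHS]tens_decomp; apply: eq_tlift => w m.
  rewrite [in RHS](coord_vbasis (memvf w)).
  rewrite (lin_sum (g := fun w => ptens w m)); last by lin.
  apply: eq_bigr => i _; rewrite ffunE (linZ (g := fun w => ptens w m)); last by lin.
  by rewrite (linZ (g := fun m => ptens _ m)) //; lin.
move=> x; rewrite linear_sum; apply/ffunP => j; rewrite sum_ffunE (bigD1 j) //=.
have fW := basis_free (vbasisP {:W}).
rewrite tens_coordsE ffunE coord_free // eqxx scale1r big1 ?addr0 // => i /negPf ij.
by rewrite tens_coordsE ffunE coord_free // ij scale0r.
Qed.

End TensorCoordinates.

Lemma annihilation_trivial_action (k : closedFieldType) (A : hopfAlgType k)
    (B : {aspace A}) : semisimple_algebra A -> 1 \in B -> normal_hopf B ->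
  annihilation_extends B -> acts_trivially B.
Proof.
move=> ssA B1 nB annB W rho rhoP M act actP.
have UP := twisted_lmodule B1 nB rhoP actP.
have TP := power_lmodule (\dim {:W}) actP.
apply: (@lmodule_iso_of_blocks k A B _ _ _ _ UP TP (tens_coords W M)) => //.
  exact: tens_coords_bij.
move=> z zB zc t; rewrite !module_opE twisted_act_central //.
rewrite (lin_tlift _ _ (lin_lfun (tens_coords W M))).
under eq_tlift => w m do rewrite tens_coordsE.
rewrite lfunE /= (lin_tlift _ _ (lmodule_linr (power_lmodule _ actP) _)).
apply: eq_tlift => w m; apply/ffunP => i; rewrite !ffunE.
by rewrite (linZ _ _ (lmodule_linr actP _)).
Qed.

Theorem theorem3p7 (k : closedFieldType) (A : hopfAlgType k) (B : {aspace A}) :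
  [pchar k] =i pred0 -> semisimple_algebra A -> hopf_subalgebra B ->
  depth_one B <-> normal_hopf B /\ acts_trivially B.
Proof.
move=> _ ssA hB; have B1 := hopf_sub1 hB; split=> [dB|[nB tB]].
  have nB := depth_one_normal ssA hB dB; split=> //.
  have [s sP sE] := depth_one_coords dB.
  exact: annihilation_trivial_action (coords_annihilation sP sE).
exact: annihilation_depth_one (trivial_action_annihilation hB nB tB).
Qed.
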